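(* Let $0<\gamma\le1$, let $D\subset\mathbb{C}^n$ be a bounded $\mathcal{C}^{1,\gamma}$-smooth domain, and for $p\in\partial D$ let $p_t:=p+t\,n_p$, where $n_p$ is the inner unit normal vector to $\partial D$ at $p$. Then for $0<\delta<\varepsilon$ small enough, $$\ell_D(p_\varepsilon,p_\delta)\gtrsim(\varepsilon-\delta)\,\varepsilon^{\frac1{2(1+\gamma)}-1}\asymp\varepsilon^{\frac1{2(1+\gamma)}}-\delta^{\frac1{2(1+\gamma)}}.$$
   Context: $\mathbb{D}$ is the open unit disc in $\mathbb{C}$ and $\mathcal{O}(\mathbb{D},D)$ is the set of holomorphic maps $\mathbb{D}\to D$. For $z,w\in D$: $\ell_D(z,w):=\inf\{|\alpha|:\alpha\in\mathbb{D},\ \exists\varphi\in\mathcal{O}(\mathbb{D},D),\ \varphi(0)=z,\ \varphi(\alpha)=w\}$. $A\gtrsim B$ means $A\ge cB$ for some constant $c>0$ independent of $\delta,\varepsilon$; $A\asymp B$ means $A\gtrsim B$ and $B\gtrsim A$. ''For $0<\delta<\varepsilon$ small enough'' means that there is $\varepsilon_0>0$ such that the estimate holds for all $0<\delta<\varepsilon<\varepsilon_0$. *)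

(* Defs.v *)
From mathcomp Require Export all_boot all_order all_algebra.
From mathcomp Require Export all_classical all_reals all_analysis.
From mathcomp Require Export complex.

Set Implicit Arguments.
Unset Strict Implicit.
Unset Printing Implicit Defensive.

Import Order.TTheory GRing.Theory Num.Theory numFieldNormedType.Exports.

Local Open Scope classical_set_scope.
Local Open Scope ring_scope.
Local Open Scope complex_scope.

(** Complex [n]-space is ['rV[R[i]^o]_n]; its library norm is the sup norm, which
    serves for the topology only.  Lengths are measured by [enorm]. *)
Definition enorm {R : realType} {n : nat} (z : 'rV[R[i]^o]_n) : R :=
  Num.sqrt (\sum_(j < n) ComplexField.Normc.normc (z 0 j) ^+ 2).

Definition domain {R : realType} {n : nat} (D : set 'rV[R[i]^o]_n) : Prop :=
  [/\ open D, connected D & D !=set0].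

Definition bdry {R : realType} {n : nat} (D : set 'rV[R[i]^o]_n) :
    set 'rV[R[i]^o]_n :=
  closure D `\` D°.

(** [R[i]^o] is [R[i]] as a normed module over itself, so [derivable] is complex
    differentiability.  Maps are total; values off the disc are irrelevant. *)
Definition holo_disc {R : realType} {n : nat} (D : set 'rV[R[i]^o]_n) :
    set (R[i] -> 'rV[R[i]^o]_n) :=
  [set phi | forall z : R[i], `|z| < 1 ->
     derivable (phi : R[i]^o -> 'rV[R[i]^o]_n) z 1 /\ D (phi z)].

(** The competing set is nonempty for [z], [w] in a domain [D]; otherwise the
    library's [inf] may return the default value [0]. *)
Definition lempert {R : realType} {n : nat} (D : set 'rV[R[i]^o]_n)
    (z w : 'rV[R[i]^o]_n) : R :=
  inf [set ComplexField.Normc.normc alpha | alpha in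
    [set alpha : R[i] | `|alpha| < 1 /\
       exists phi, [/\ holo_disc D phi, phi 0 = z & phi alpha = w]]].

Definition of_real {R : realType} {n : nat} (xy : 'rV[R]_n * 'rV[R]_n) :
    'rV[R[i]^o]_n :=
  \row_j (xy.1 0 j +i* xy.2 0 j).

Definition to_real {R : realType} {n : nat} (z : 'rV[R[i]^o]_n) :
    'rV[R]_n * 'rV[R]_n :=
  (\row_j complex.Re (z 0 j), \row_j complex.Im (z 0 j)).

Definition rdifferentiable {R : realType} {n : nat} (r : 'rV[R[i]^o]_n -> R)
    (z : 'rV[R[i]^o]_n) : Prop :=
  differentiable (r \o of_real) (to_real z).

(** The real gradient, with [j]-th entry [dr/dx_j + i dr/dy_j]. *)
Definition rgrad {R : realType} {n : nat} (r : 'rV[R[i]^o]_n -> R)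
    (z : 'rV[R[i]^o]_n) : 'rV[R[i]^o]_n :=
  \row_j ('D_(delta_mx 0 j, 0) (r \o of_real) (to_real z)
          +i* 'D_(0, delta_mx 0 j) (r \o of_real) (to_real z)).

Definition C1gamma_on {R : realType} {n : nat} (gamma : R)
    (U : set 'rV[R[i]^o]_n) (r : 'rV[R[i]^o]_n -> R) : Prop :=
  (forall z, U z -> rdifferentiable r z) /\
  exists L : R, forall z w, U z -> U w ->
    enorm (rgrad r z - rgrad r w) <= L * enorm (z - w) `^ gamma.

Definition local_defining {R : realType} {n : nat} (gamma : R)
    (D : set 'rV[R[i]^o]_n) (p : 'rV[R[i]^o]_n)
    (U : set 'rV[R[i]^o]_n) (r : 'rV[R[i]^o]_n -> R) : Prop :=
  [/\ open U, U p, C1gamma_on gamma U r,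
      (forall z, U z -> rgrad r z != 0) &
      D `&` U = [set z | U z /\ r z < 0]].

Definition C1gamma_smooth {R : realType} {n : nat} (gamma : R)
    (D : set 'rV[R[i]^o]_n) : Prop :=
  forall p, bdry D p -> exists U r, local_defining gamma D p U r.

(** [r] is negative inside [D], so the inner normal is minus the normalized
    gradient; it does not depend on the local defining function. *)
Definition inner_unit_normal {R : realType} {n : nat} (gamma : R)
    (D : set 'rV[R[i]^o]_n) (p nu : 'rV[R[i]^o]_n) : Prop :=
  exists U r, local_defining gamma D p U r /\
    nu = - ((enorm (rgrad r p))^-1)%:C *: rgrad r p.

(** For quantities depending on [(eps, delta)], in this order. *)
Definition gtrsim {R : realType} (A B : R -> R -> R) : Prop :=
  exists c eps0 : R, [/\ 0 < c, 0 < eps0 &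
    forall delta eps : R, 0 < delta -> delta < eps -> eps < eps0 ->
      c * B eps delta <= A eps delta].

Definition asymp {R : realType} (A B : R -> R -> R) : Prop :=
  gtrsim A B /\ gtrsim B A.

(* Main.v *)
Require Import Defs.
From mathcomp Require Import ring lra.
Set Implicit Arguments.
Unset Strict Implicit.
Unset Printing Implicit Defensive.
Import Order.TTheory GRing.Theory Num.Theory numFieldNormedType.Exports.
Local Open Scope classical_set_scope.
Local Open Scope ring_scope.
Local Open Scope complex_scope.

(** Let phi be a holomorphic map of the unit disc into D with phi(0) = p_eps and
    phi(alpha) = p_delta, and let f(z) be the component of phi(z) - p along the
    inner normal nu, so that f(0) = eps and f(alpha) = delta.  The quantity to
    bound from above is the speed t = (eps - delta) / |alpha|.

    Near p the domain lies in { Re <z - p, nu> >= - C |z - p|^(1+gamma) }, by a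
    first-order Taylor expansion of a defining function whose gradient is Hoelder
    (normal_lower); enlarging C makes this hold on all of D.  If |phi - p| <= X on
    a neighbourhood of 0 of size s, then there f takes values in the half-plane
    Re >= - C X^(1+gamma), and the Schwarz lemma for this half-plane gives
    t s <= const X^(1+gamma) as soon as eps <= X^(1+gamma) (disc_step).

    Boundedness of D alone gives |phi(z) - p| = O(eps + |z|), which shows that t
    tends to 0 with eps (speed_small).  The gain comes from the fact that
    phi - p_eps is parallel to nu at both points 0 and alpha, so the components of
    phi have difference quotients of order one at 0 and alpha of size at most t,
    and second order difference quotients that are O(1):
    |phi(z) - p| = O(eps + t |z| + |z| |z - alpha|) (second_growth).  On the scale
    s = max(t, eps^a) with a = 1 / (2 (1 + gamma)), and |alpha| <= s, this is
    O(s^2), hence t <= A s^(1 + 2 gamma).  Since t is small, s = t is impossible,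
    so s = eps^a and t <= A eps^(1 - a), which is the claim (normal_disc_lower).

    The two comparable quantities are (1 - x) eps^a and (1 - x^a) eps^a with
    x = delta / eps, and concavity of x^a compares them (asymp_diff).  The
    infimum that defines the Lempert function runs over a nonempty set: the disc
    z |-> p + eps sqrt(1 + z) nu stays in the part of D that lies in a right-angled
    cone with axis nu (lempert_set_nonempty).

    The Schwarz lemmas are derived for maps that are only assumed to be complex
    differentiable at each point.  Goursat's bisection argument is carried out for
    a real form P dx + Q dy on a rectangle (goursat_rect).  Applied to
    f(c + exp(x + iy)) on [x1, x0] x [0, 2 pi], it says that the mean of Re f over
    circles around c does not depend on the radius, even if f is merely continuous
    at c.  The maximum principle follows, with removable singularities built in
    (max_square); applied to difference quotients it yields the bounds on phi. *)

(** * Integrals of continuous functions over a segment *)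

Definition seg_int {R : realType} (f : R -> R) (a b : R) : R :=
  \int[lebesgue_measure]_(x in `[a, b]) f x.

Definition cont_on {R : realType} (f : R -> R) (a b : R) : Prop :=
  forall x : R, a <= x <= b -> {for x, continuous f}.

Lemma cont_on_integrable {R : realType} (f : R -> R) (a b : R) :
  cont_on f a b -> lebesgue_measure.-integrable `[a, b] (EFin \o f).
Proof.
move=> cf; apply: continuous_compact_integrable; first exact: segment_compact.
by apply: continuous_in_subspaceT => x; rewrite inE /= in_itv /= => /cf.
Qed.

Lemma cont_on_sub {R : realType} (f : R -> R) (a b c d : R) :
  a <= c -> d <= b -> cont_on f a b -> cont_on f c d.
Proof.
by move=> ac db cf x /andP[cx xd]; apply: cf; rewrite (le_trans ac) ?(le_trans xd).
Qed.

Lemma cont_onB {R : realType} (f g : R -> R) (a b : R) :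
  cont_on f a b -> cont_on g a b -> cont_on (fun x => f x - g x) a b.
Proof. by move=> cf cg x xab; apply: cvgB; [exact: cf|exact: cg]. Qed.

Lemma seg_int_split {R : realType} (f : R -> R) (a m b : R) :
  a <= m -> m <= b -> cont_on f a b -> seg_int f a b = seg_int f a m + seg_int f m b.
Proof.
move=> am mb cf; rewrite /seg_int.
have := @Rintegral_itvB R f (BLeft a) (BRight b) m (cont_on_integrable cf).
rewrite !bnd_simp => /(_ am mb); rewrite Rintegral_itv_obnd_cbnd; last first.
  apply: integrableS (cont_on_integrable (cont_on_sub am (lexx b) cf)) => //.
  by apply: subset_itvr; rewrite bnd_simp.
by move=> <-; rewrite addrC subrK.
Qed.


Lemma seg_intB {R : realType} (f g : R -> R) (a b : R) :
  cont_on f a b -> cont_on g a b ->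
  seg_int (fun x => f x - g x) a b = seg_int f a b - seg_int g a b.
Proof. by move=> cf cg; apply: RintegralB => //; exact: cont_on_integrable. Qed.

Lemma seg_int_cst {R : realType} (k a b : R) : a <= b ->
  seg_int (fun=> k) a b = k * (b - a).
Proof.
move=> ab; rewrite /seg_int Rintegral_cst//= lebesgue_measure_itv/= lte_fin.
move: ab; rewrite le_eqVlt => /predU1P[->|ab]; first by rewrite ltxx subrr.
by rewrite ab -EFinB.
Qed.

Lemma seg_int_le {R : realType} (f g : R -> R) (a b : R) :
  cont_on f a b -> cont_on g a b ->
  (forall x, a <= x <= b -> f x <= g x) -> seg_int f a b <= seg_int g a b.
Proof.
move=> cf cg fg; apply: le_Rintegral => //; try exact: cont_on_integrable.
Qed.

Lemma seg_int_near_cst {R : realType} (f : R -> R) (a b k e : R) :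
  a <= b -> cont_on f a b ->
  (forall x, a <= x <= b -> `|f x - k| <= e) ->
  `|seg_int f a b - k * (b - a)| <= e * (b - a).
Proof.
move=> ab cf fk.
have cc (l : R) : cont_on (fun=> l) a b by move=> x _; exact: cvg_cst.
have h1 : seg_int f a b <= (k + e) * (b - a).
  rewrite -seg_int_cst//; apply: seg_int_le => // x /fk; rewrite ler_norml => /andP[_ ?].
  by lra.
have h2 : (k - e) * (b - a) <= seg_int f a b.
  rewrite -seg_int_cst//; apply: seg_int_le => // x /fk; rewrite ler_norml => /andP[? _].
  by lra.
by rewrite ler_norml; apply/andP; split; lra.
Qed.

(** * Goursat's theorem for closed forms on rectangles *)

(** Both [P] and [Q] are differentiable at the point, and the form
    [P dx + Q dy] is closed there: [B] is at once [dP/dy] and [dQ/dx]. *)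
Definition closed_form_at {R : realType} (P Q : R -> R -> R) (x y : R) : Prop :=
  exists A B C : R, forall e : R, 0 < e -> exists2 d : R, 0 < d &
    forall x' y', `|x' - x| < d -> `|y' - y| < d ->
      `|P x' y' - P x y - (A * (x' - x) + B * (y' - y))|
         <= e * (`|x' - x| + `|y' - y|) /\
      `|Q x' y' - Q x y - (B * (x' - x) + C * (y' - y))|
         <= e * (`|x' - x| + `|y' - y|).

(** The circulation of [P dx + Q dy] along the boundary of the rectangle
    [[a, b] x [c, d]], counterclockwise.  Opposite sides are grouped under one
    integral, so that constant and affine parts of the form cancel inside the
    integrands. *)
Definition rect_int {R : realType} (P Q : R -> R -> R) (a b c d : R) : R :=
  seg_int (fun x => P x c - P x d) a b + seg_int (fun y => Q b y - Q a y) c d.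

Lemma affine_approx_cont {R : realType} (f : R -> R) (x k : R) :
  (forall e : R, 0 < e -> exists2 d : R, 0 < d & forall x', `|x' - x| < d ->
     `|f x' - f x - k * (x' - x)| <= e * `|x' - x|) -> {for x, continuous f}.
Proof.
move=> H; apply/cvgrPdist_le => e e0.
have [d d0 Hd] := H 1 ltr01.
have D0 : 0 < Num.min d (e / (1 + `|k|)).
  by rewrite lt_min d0 divr_gt0// ltr_pwDl.
apply/nbhs_ballP; exists (Num.min d (e / (1 + `|k|))) => //= t.
rewrite /ball /= distrC lt_min ltr_pdivlMr ?ltr_pwDl// => /andP[td te].
have h := Hd _ td; rewrite mul1r in h.
have -> : f x - f t = - (f t - f x - k * (t - x)) - k * (t - x) by ring.
apply: le_trans (ler_normB _ _) _; rewrite normrN normrM.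
apply: le_trans (lerD h (lexx _)) _.
by rewrite -[X in X + _]mul1r -mulrDl mulrC ltW.
Qed.

Lemma closed_form_cont1 {R : realType} (P Q : R -> R -> R) (x y : R) :
  closed_form_at P Q x y -> {for x, continuous (P^~ y)}.
Proof.
move=> [A [B [C H]]]; apply: (@affine_approx_cont _ _ _ A) => e e0.
have [d d0 Hd] := H _ e0; exists d => // x' xd.
have := Hd x' y xd; rewrite subrr normr0 mulr0 !addr0.
by move=> /(_ d0)[].
Qed.

Lemma closed_form_cont2 {R : realType} (P Q : R -> R -> R) (x y : R) :
  closed_form_at P Q x y -> {for y, continuous (Q x)}.
Proof.
move=> [A [B [C H]]]; apply: (@affine_approx_cont _ _ _ C) => e e0.
have [d d0 Hd] := H _ e0; exists d => // x' xd.
have := Hd x x'; rewrite subrr normr0 !mulr0 !add0r.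
by move=> /(_ d0 xd)[].
Qed.

Definition closed_form_on {R : realType} (P Q : R -> R -> R) (a b c d : R) : Prop :=
  forall x y, a <= x <= b -> c <= y <= d -> closed_form_at P Q x y.

Section rect.
Context {R : realType} (P Q : R -> R -> R).

Lemma closed_form_contP a b c d y : closed_form_on P Q a b c d -> c <= y <= d ->
  cont_on (P^~ y) a b.
Proof. by move=> H yd x xd; exact: (closed_form_cont1 (H _ _ xd yd)). Qed.

Lemma closed_form_contQ a b c d x : closed_form_on P Q a b c d -> a <= x <= b ->
  cont_on (Q x) c d.
Proof. by move=> H xd y yd; exact: (closed_form_cont2 (H _ _ xd yd)). Qed.

Lemma rect_int_split1 a m b c d : a <= m -> m <= b -> c <= d ->
  closed_form_on P Q a b c d ->
  rect_int P Q a b c d = rect_int P Q a m c d + rect_int P Q m b c d.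
Proof.
move=> am mb cd H; rewrite /rect_int.
have ab := le_trans am mb.
have cP y : c <= y <= d -> cont_on (P^~ y) a b by exact: closed_form_contP.
have cQ x : a <= x <= b -> cont_on (Q x) c d by exact: closed_form_contQ.
rewrite (seg_int_split am mb); last by apply: cont_onB; apply: cP; rewrite ?lexx ?cd.
rewrite !seg_intB; try by apply: cQ; rewrite ?lexx ?ab ?am ?mb.
by ring.
all: by apply: cont_on_sub (cP _ _); rewrite ?lexx ?cd.
Qed.

Lemma rect_int_split2 a b c m d : a <= b -> c <= m -> m <= d ->
  closed_form_on P Q a b c d ->
  rect_int P Q a b c d = rect_int P Q a b c m + rect_int P Q a b m d.
Proof.
move=> ab cm md H; rewrite /rect_int.
have cd := le_trans cm md.
have cP y : c <= y <= d -> cont_on (P^~ y) a b by exact: closed_form_contP.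
have cQ x : a <= x <= b -> cont_on (Q x) c d by exact: closed_form_contQ.
rewrite (seg_int_split cm md); last by apply: cont_onB; apply: cQ; rewrite ?lexx ?ab.
rewrite !seg_intB; try by apply: cP; rewrite ?lexx ?cd ?cm ?md.
by ring.
all: by apply: cont_on_sub (cQ _ _); rewrite ?lexx ?ab.
Qed.

(** Replacing the form by its affine approximation at [(x, y)] changes the
    integrands by at most [2 e] times the half-perimeter, and the closed affine
    form contributes [B * (c - d) * (b - a)] and its opposite.  The bound is
    quadratic in the size of the rectangle, hence of the same order as its area
    under bisection. *)
Lemma rect_int_small a b c d x y A B C e :
  closed_form_on P Q a b c d -> a <= x <= b -> c <= y <= d ->
  (forall x' y', a <= x' <= b -> c <= y' <= d ->
      `|P x' y' - P x y - (A * (x' - x) + B * (y' - y))|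
         <= e * (`|x' - x| + `|y' - y|) /\
      `|Q x' y' - Q x y - (B * (x' - x) + C * (y' - y))|
         <= e * (`|x' - x| + `|y' - y|)) ->
  0 <= e ->
  `|rect_int P Q a b c d| <= 2 * e * ((b - a) + (d - c)) ^+ 2.
Proof.
move=> H xab ycd E e0.
have ab : a <= b by case/andP: xab; exact: le_trans.
have cd : c <= d by case/andP: ycd; exact: le_trans.
set l := (b - a) + (d - c).
have El x' y' : a <= x' <= b -> c <= y' <= d ->
      `|P x' y' - P x y - (A * (x' - x) + B * (y' - y))| <= e * l /\
      `|Q x' y' - Q x y - (B * (x' - x) + C * (y' - y))| <= e * l.
  move=> hx hy; have [h1 h2] := E _ _ hx hy.
  suff h : e * (`|x' - x| + `|y' - y|) <= e * l by split; apply: le_trans h.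
  apply: ler_wpM2l => //; apply: lerD; rewrite ler_norml; lra.
have h1 : `|seg_int (fun x => P x c - P x d) a b - B * (c - d) * (b - a)|
    <= (2 * e * l) * (b - a).
  apply: seg_int_near_cst => //.
    by apply: cont_onB; apply: closed_form_contP H _; rewrite ?lexx ?cd.
  move=> x' hx'.
  have [+ _] := El x' c hx' ltac:(by rewrite lexx cd).
  have [+ _] := El x' d hx' ltac:(by rewrite lexx cd).
  rewrite !ler_norml => /andP[? ?] /andP[? ?]; apply/andP; split; lra.
have h2 : `|seg_int (fun y => Q b y - Q a y) c d - B * (b - a) * (d - c)|
    <= (2 * e * l) * (d - c).
  apply: seg_int_near_cst => //.
    by apply: cont_onB; apply: closed_form_contQ H _; rewrite ?lexx ?ab.
  move=> y' hy'.
  have [_ +] := El a y' ltac:(by rewrite lexx ab) hy'.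
  have [_ +] := El b y' ltac:(by rewrite lexx ab) hy'.
  rewrite !ler_norml => /andP[? ?] /andP[? ?]; apply/andP; split; lra.
rewrite /rect_int; set I1 := seg_int _ _ _ in h1 *; set I2 := seg_int _ _ _ in h2 *.
have -> : I1 + I2 = (I1 - B * (c - d) * (b - a)) + (I2 - B * (b - a) * (d - c)).
  by ring.
apply: le_trans (ler_normD _ _) _; apply: le_trans (lerD h1 h2) _.
by rewrite -mulrDr -/l expr2 mulrA.
Qed.

End rect.

Lemma nested_intervals {R : realType} (a b : nat -> R) :
  (forall k, a k <= a k.+1) -> (forall k, b k.+1 <= b k) ->
  (forall k, a k <= b k) -> exists x, forall k, a k <= x <= b k.
Proof.
move=> ai bd ab.
have am k m : (k <= m)%N -> a k <= a m.
  by move=> km; exact: (@homo_leq _ a (fun x y => x <= y) (@lexx _ _) (@le_trans _ _) ai).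
have bm k m : (k <= m)%N -> b m <= b k.
  move=> km; apply: (@homo_leq _ b (fun x y => y <= x)) => //.
  by move=> y x z xy yz; exact: le_trans yz xy.
have amb k m : a k <= b m.
  apply: le_trans (am _ _ (leq_maxl k m)) _.
  by apply: le_trans (ab _) _; apply: bm; exact: leq_maxr.
exists (sup (range a)) => k; apply/andP; split.
  apply: ub_le_sup; last by exists k.
  by exists (b 0%N) => _ [m _ <-].
by apply: ge_sup; [exists (a 0%N), 0%N|move=> _ [m _ <-]].
Qed.

Lemma half_pow_lt {R : realType} (w d : R) : 0 < d -> exists k, w / 2 ^+ k < d.
Proof.
move=> d0; exists (Num.bound `|w / d|).
rewrite ltr_pdivrMr ?exprn_gt0// mulrC -ltr_pdivrMr//.
apply: le_lt_trans (ler_norm _) _; apply: lt_trans (archi_boundP (normr_ge0 _)) _.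
set m := Num.bound _.
have : (m < 2 ^ m)%N by apply: ltn_expl.
by rewrite -(ltr_nat R) natrX.
Qed.

Section goursat.
Context {R : realType} (P Q : R -> R -> R) (a c w h : R).
Hypotheses (w0 : 0 <= w) (h0 : 0 <= h).
Hypothesis PQ : closed_form_on P Q a (a + w) c (c + h).

Let I (k : nat) (p : R * R) :=
  rect_int P Q p.1 (p.1 + w / 2 ^+ k) p.2 (p.2 + h / 2 ^+ k).

Let ins (k : nat) (p : R * R) : Prop :=
  [/\ a <= p.1, p.1 + w / 2 ^+ k <= a + w, c <= p.2 &
      p.2 + h / 2 ^+ k <= c + h].

Let nested (k : nat) (p q : R * R) : Prop :=
  [/\ p.1 <= q.1, q.1 + w / 2 ^+ k.+1 <= p.1 + w / 2 ^+ k, p.2 <= q.2 &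
      q.2 + h / 2 ^+ k.+1 <= p.2 + h / 2 ^+ k].

(** The bound [e * size ^ 2] on the circulation is inherited by a rectangle from its
    four quarters, since the size is halved and there are four of them. *)
Lemma bad_quarter (e : R) (k : nat) (p : R * R) : ins k p ->
  e * ((w + h) / 2 ^+ k) ^+ 2 < `|I k p| ->
  exists q, [/\ nested k p q, ins k.+1 q &
    e * ((w + h) / 2 ^+ k.+1) ^+ 2 < `|I k.+1 q|].
Proof.
move=> [i1 i2 i3 i4] bad.
set w' := w / 2 ^+ k.+1; set h' := h / 2 ^+ k.+1.
have Ew : w / 2 ^+ k = w' + w'.
  by rewrite /w' exprS; field; rewrite expf_neq0.
have Eh : h / 2 ^+ k = h' + h'.
  by rewrite /h' exprS; field; rewrite expf_neq0.
have w'0 : 0 <= w' by rewrite divr_ge0// exprn_ge0.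
have h'0 : 0 <= h' by rewrite divr_ge0// exprn_ge0.
apply: contrapT => H.
have small q : q = p \/ q = (p.1 + w', p.2) \/ q = (p.1, p.2 + h') \/
    q = (p.1 + w', p.2 + h') ->
    `|I k.+1 q| <= e * ((w + h) / 2 ^+ k.+1) ^+ 2.
  move=> Hq; rewrite leNgt; apply/negP => bq; apply: H; exists q.
  rewrite /nested /ins -/w' -/h' Ew Eh; rewrite Ew in i2; rewrite Eh in i4.
  by case: Hq => [|[|[|]]] Hq; rewrite Hq/=; rewrite Hq in bq; split => //;
    split; lra.
have s1 := small p (or_introl erefl).
have s2 := small _ (or_intror (or_introl erefl)).
have s3 := small _ (or_intror (or_intror (or_introl erefl))).
have s4 := small _ (or_intror (or_intror (or_intror erefl))).
move: bad s1 s2 s3 s4; rewrite /I /= -/w' -/h' Ew Eh.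
rewrite Ew in i2; rewrite Eh in i4.
have sub a' b' c' d' : a <= a' -> b' <= a + w -> c <= c' -> d' <= c + h ->
    closed_form_on P Q a' b' c' d'.
  move=> ha hb hc hd x y /andP[? ?] /andP[? ?]; apply: PQ; apply/andP; split; lra.
rewrite (@rect_int_split1 _ _ _ p.1 (p.1 + w'));
  [|lra|lra|lra|by apply: sub; lra].
rewrite (@rect_int_split2 _ _ _ p.1 (p.1 + w') p.2 (p.2 + h'));
  [|lra|lra|lra|by apply: sub; lra].
rewrite (@rect_int_split2 _ _ _ (p.1 + w') _ p.2 (p.2 + h'));
  [|lra|lra|lra|by apply: sub; lra].
rewrite -!(addrA p.1) -!(addrA p.2).
have -> : (w + h) / 2 ^+ k = 2 * ((w + h) / 2 ^+ k.+1).
  by rewrite exprS; field; rewrite expf_neq0.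
set l := (w + h) / _.
set I1 := rect_int _ _ p.1 _ p.2 _; set I2 := rect_int _ _ p.1 _ (p.2 + _) _.
set I3 := rect_int _ _ (p.1 + _) _ p.2 _.
set I4 := rect_int _ _ (p.1 + _) _ (p.2 + _) _.
have := ler_normD (I1 + I2) (I3 + I4); have := ler_normD I1 I2.
have := ler_normD I3 I4.
rewrite exprMn => ? ? ? ? ? ? ? ?; lra.
Qed.

(** If the circulation did not vanish, quadrisection would produce a nested sequence
    of rectangles all of which violate the quadratic bound; differentiability at
    their common point contradicts this for small rectangles. *)
Theorem goursat_rect : rect_int P Q a (a + w) c (c + h) = 0.
Proof.
(* A rectangle reduced to a point has zero circulation; it is set apart because
   [e] below is divided by the size of the rectangle. *)
have [l0|lp] := leP (w + h) 0.
  have w00 : w = 0 by move: w0 h0 => *; lra.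
  have h00 : h = 0 by move: w0 h0 => *; lra.
  have : `|rect_int P Q a (a + w) c (c + h)| <=
      2 * 1 * ((a + w - a) + (c + h - c)) ^+ 2.
    apply: (@rect_int_small _ _ _ _ _ _ _ a c 0 0 0) => //; try lra.
    rewrite w00 h00 !addr0 => x' y' hx hy.
    have -> : x' = a by lra.
    have -> : y' = c by lra.
    by rewrite !subrr !mulr0 !addr0 subrr normr0 addr0 mulr0.
  rewrite w00 h00 !addr0 !subrr addr0 expr0n/= mulr0 => hI.
  by apply/eqP; rewrite -normr_le0.
apply/eqP; apply: contrapT => /negP nz.
set e := `|rect_int P Q a (a + w) c (c + h)| / (4 * (w + h) ^+ 2).
have e0 : 0 < e by rewrite divr_gt0 ?normr_gt0// mulr_gt0// exprn_gt0.
(* The factor 2 is the one of [rect_int_small]; the 4 in [e] makes the whole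
   rectangle violate the bound strictly. *)
pose Bad k p := ins k p /\ (2 * e) * ((w + h) / 2 ^+ k) ^+ 2 < `|I k p|.
have step k p : exists q, Bad k p -> nested k p q /\ Bad k.+1 q.
  have [[i b]|nb] := pselect (Bad k p); last by exists p.
  by have [q [? ? ?]] := bad_quarter i b; exists q.
have [f Hf] := choice (fun kp : nat * (R * R) => step kp.1 kp.2).
pose u := fix u k := if k is k'.+1 then f (k', u k') else (a, c).
have uS k : u k.+1 = f (k, u k) by [].
have B k : Bad k (u k).
  elim: k => [|k IH]; last by have [] := Hf (k, u k) IH; rewrite -uS.
  split; first by split; rewrite /= ?expr0 ?divr1.
  rewrite /I /= expr0 !divr1.
  set J := `|_|; have J0 : 0 < J by rewrite normr_gt0.
  have -> : 2 * e * (w + h) ^+ 2 = J / 2.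
    by rewrite /e -/J; field; rewrite gt_eqF.
  lra.
have N k : nested k (u k) (u k.+1) by have [] := Hf (k, u k) (B k).
have [x Hx] : exists x, forall k, (u k).1 <= x <= (u k).1 + w / 2 ^+ k.
  apply: nested_intervals => k; try by case: (N k).
  by rewrite lerDl divr_ge0 // exprn_ge0.
have [y Hy] : exists y, forall k, (u k).2 <= y <= (u k).2 + h / 2 ^+ k.
  apply: nested_intervals => k; try by case: (N k).
  by rewrite lerDl divr_ge0 // exprn_ge0.
have := Hx 0%N; have := Hy 0%N; rewrite /= expr0 !divr1 => hy hx.
have [A [B' [C H]]] := PQ hx hy.
have [d d0 Hd] := H _ e0.
have [k Hk] := half_pow_lt (w + h) d0.
have [[i1 i2 i3 i4] +] := B k; apply/negP; rewrite -leNgt.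
have -> : (w + h) / 2 ^+ k =
  ((u k).1 + w / 2 ^+ k - (u k).1) + ((u k).2 + h / 2 ^+ k - (u k).2) by ring.
rewrite mulrDl in Hk.
have wk : 0 <= w / 2 ^+ k by rewrite divr_ge0 // exprn_ge0.
have hk : 0 <= h / 2 ^+ k by rewrite divr_ge0 // exprn_ge0.
move: (Hx k) (Hy k) => hxk hyk.
apply: (@rect_int_small _ _ _ _ _ _ _ x y A B' C) => //; last exact: ltW.
  move=> x' y' /andP[? ?] /andP[? ?]; apply: PQ; apply/andP; split; lra.
by move=> x' y' ? ?; apply: Hd; rewrite ltr_norml; apply/andP; split; lra.
Qed.

End goursat.

(** * Modulus, continuity and complex differentiability *)

Lemma derivable_lin {K : numFieldType} (f : K^o -> K^o) (x : K^o) :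
  derivable f x 1 -> forall e : K, 0 < e -> exists2 d : K, 0 < d &
    forall y, `|y - x| < d ->
      `|f y - f x - 'D_1 f x * (y - x)| <= e * `|y - x|.
Proof.
move=> df e e0.
have /cvgrPdist_le/(_ _ e0) : (h^-1 *: ((f \o shift x) (h *: 1) - f x))
    @[h --> 0^'] --> 'D_1 f x by exact: df.
rewrite /dnbhs /= => /nbhs_ballP[d d0 Hd]; exists d => // y yx.
have [->|nyx] := eqVneq y x; first by rewrite !subrr mulr0 subr0 !normr0 mulr0.
have nz : y - x != 0 by rewrite subr_eq0.
have := Hd (y - x); rewrite /ball /= sub0r normrN => /(_ yx nz) h.
have {}h : `|'D_1 f x - (y - x)^-1 * (f y - f x)| <= e.
  by move: h; rewrite /= -[(y - x) *: 1]/((y - x) * 1) mulr1 subrK.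
have -> : f y - f x - 'D_1 f x * (y - x) =
    - ('D_1 f x - (y - x)^-1 * (f y - f x)) * (y - x) by field.
by rewrite normrM normrN ler_wpM2r.
Qed.

Lemma lin_derivable {K : numFieldType} (f : K^o -> K^o) (x l : K^o) :
  (forall e : K, 0 < e -> exists2 d : K, 0 < d &
    forall y, `|y - x| < d ->
      `|f y - f x - l * (y - x)| <= e * `|y - x|) -> derivable f x 1.
Proof.
move=> H; apply/cvg_ex; exists l; apply/cvgrPdist_le => e e0.
have [d d0 Hd] := H _ e0.
rewrite /dnbhs /=; apply/nbhs_ballP; exists d => //= h.
rewrite /ball /= sub0r normrN => hd h0.
have := Hd (h + x); rewrite addrK => /(_ hd).
rewrite -[h *: 1]/(h * 1) mulr1 => {}Hd.
rewrite -(ler_pM2r (_ : 0 < `|h|)) ?normr_gt0//; apply: le_trans Hd.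
rewrite -normrM.
have -> : (l - h^-1 *: (f (h + x) - f x)) * h = - (f (h + x) - f x - l * h).
  by rewrite -[_ *: _]/(h^-1 * _); field.
by rewrite normrN.
Qed.

(** The modulus with values in [R]; the norm of [R[i]] takes its values in
    [R[i]]. *)
Notation cmod := ComplexField.Normc.normc.

Section cmod.
Context {R : realType}.
Implicit Types z w : R[i].

Lemma cmodE z : `|z| = (cmod z)%:C. Proof. by []. Qed.
Lemma cmod_ge0 z : 0 <= cmod z. Proof. by case: z => a b; exact: sqrtr_ge0. Qed.
Lemma cmodD z w : cmod (z + w) <= cmod z + cmod w. Proof. exact: le_normcD. Qed.
Lemma cmodN z : cmod (- z) = cmod z. Proof. exact: normcN. Qed.
Lemma cmodM z w : cmod (z * w) = cmod z * cmod w.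
Proof. exact: ComplexField.Normc.normcM. Qed.
Lemma cmodV z : cmod z^-1 = (cmod z)^-1.
Proof. exact: ComplexField.Normc.normcV. Qed.
Lemma cmod0 : cmod (0 : R[i]) = 0. Proof. exact: ComplexField.Normc.normc0. Qed.
Lemma cmod1 : cmod (1 : R[i]) = 1. Proof. exact: ComplexField.Normc.normc1. Qed.
Lemma cmodB z w : cmod (z - w) <= cmod z + cmod w.
Proof. by rewrite -(cmodN w) cmodD. Qed.
Lemma cmodBC z w : cmod (z - w) = cmod (w - z).
Proof. by rewrite -cmodN opprB. Qed.
Lemma cmod_eq0 z : (cmod z == 0) = (z == 0).
Proof.
by apply/eqP/eqP => [/ComplexField.Normc.eq0_normc//|->]; rewrite cmod0.
Qed.
Lemma cmod_gt0 z : (0 < cmod z) = (z != 0).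
Proof. by rewrite lt_def cmod_ge0 andbT cmod_eq0. Qed.
Lemma cmod_real (x : R) : cmod x%:C = `|x|.
Proof. by rewrite /= expr0n addr0 sqrtr_sqr. Qed.
Lemma cmod_sqr z : cmod z ^+ 2 = complex.Re z ^+ 2 + complex.Im z ^+ 2.
Proof. by case: z => a b; rewrite /= sqr_sqrtr// addr_ge0// sqr_ge0. Qed.
Lemma Re_le_cmod z : `|complex.Re z| <= cmod z.
Proof.
by rewrite -(ler_pXn2r (n := 2))// ?nnegrE ?cmod_ge0// cmod_sqr real_normK ?num_real// lerDl sqr_ge0.
Qed.
Lemma Im_le_cmod z : `|complex.Im z| <= cmod z.
Proof.
by rewrite -(ler_pXn2r (n := 2))// ?nnegrE ?cmod_ge0// cmod_sqr real_normK ?num_real// lerDr sqr_ge0.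
Qed.
Lemma cmod_le_ReIm z : cmod z <= `|complex.Re z| + `|complex.Im z|.
Proof.
rewrite -(ler_pXn2r (n := 2))// ?nnegrE ?cmod_ge0 ?addr_ge0// cmod_sqr sqrrD.
by rewrite !real_normK ?num_real// addrAC lerDl mulrn_wge0// mulr_ge0.
Qed.
Lemma cReD z w : complex.Re (z + w) = complex.Re z + complex.Re w.
Proof. by case: z w => ? ? []. Qed.
Lemma cImD z w : complex.Im (z + w) = complex.Im z + complex.Im w.
Proof. by case: z w => ? ? []. Qed.
Lemma cReN z : complex.Re (- z) = - complex.Re z. Proof. by case: z. Qed.
Lemma cImN z : complex.Im (- z) = - complex.Im z. Proof. by case: z. Qed.
Lemma cReM z w :
  complex.Re (z * w) = complex.Re z * complex.Re w - complex.Im z * complex.Im w.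
Proof. by case: z w => ? ? []. Qed.
Lemma cImM z w :
  complex.Im (z * w) = complex.Re z * complex.Im w + complex.Im z * complex.Re w.
Proof. by case: z w => ? ? []. Qed.
Lemma cReZ (k : R) z : complex.Re (k%:C * z) = k * complex.Re z.
Proof. by rewrite cReM /= mul0r subr0. Qed.
Lemma Re_le z : complex.Re z <= cmod z.
Proof. exact: le_trans (ler_norm _) (Re_le_cmod z). Qed.

Lemma ltc_cmod z (r : R) : (`|z| < r%:C) = (cmod z < r).
Proof. by rewrite cmodE ltcR. Qed.

Lemma cpos_real z : 0 < z -> exists2 r : R, 0 < r & z = r%:C.
Proof. by case: z => a b; rewrite ltcE /= => /andP[/eqP -> a0]; exists a. Qed.

Lemma cmod_lt1 z : (`|z| < 1) = (cmod z < 1).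
Proof. by rewrite -[1]/(1%:C) ltcR. Qed.

Lemma cderivable_lin (f : R[i]^o -> R[i]^o) z : derivable f z 1 ->
  exists l : R[i], forall e : R, 0 < e -> exists2 d : R, 0 < d &
    forall w, cmod (w - z) < d ->
      cmod (f w - f z - l * (w - z)) <= e * cmod (w - z).
Proof.
move=> /derivable_lin H; exists ('D_1 f z) => e e0.
have [|d /cpos_real[r r0 ->] Hr] := H e%:C; first by rewrite ltcR.
exists r => // w wz; rewrite -lecR rmorphM -!cmodE; apply: Hr.
by rewrite ltc_cmod.
Qed.

Lemma lin_cderivable (f : R[i]^o -> R[i]^o) z (l : R[i]) :
  (forall e : R, 0 < e -> exists2 d : R, 0 < d &
    forall w, cmod (w - z) < d ->
      cmod (f w - f z - l * (w - z)) <= e * cmod (w - z)) ->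
  derivable f z 1.
Proof.
move=> H; apply: (@lin_derivable _ f z l) => e /cpos_real[r r0 ->].
have [d d0 Hd] := H r r0; exists d%:C; first by rewrite ltcR.
move=> w; rewrite ltc_cmod => /Hd.
by rewrite -lecR rmorphM -!cmodE.
Qed.

End cmod.

Definition ccont {R : realType} (f : R[i] -> R[i]) (z : R[i]) : Prop :=
  forall e : R, 0 < e -> exists2 d : R, 0 < d &
    forall w, cmod (w - z) < d -> cmod (f w - f z) <= e.

Lemma derivable_ccont {R : realType} (f : R[i]^o -> R[i]^o) z :
  derivable f z 1 -> ccont f z.
Proof.
move=> /cderivable_lin [l H] e e0.
have [d d0 Hd] := H 1 ltr01.
exists (Num.min d (e / (1 + cmod l))).
  by rewrite lt_min d0 divr_gt0// ltr_pwDl// cmod_ge0.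
move=> w; rewrite lt_min ltr_pdivlMr ?ltr_pwDl ?cmod_ge0// => /andP[wd we].
have -> : f w - f z = f w - f z - l * (w - z) + l * (w - z) by rewrite subrK.
apply: le_trans (cmodD _ _) _; apply: le_trans (lerD (Hd _ wd) (lexx _)) _.
by rewrite cmodM -mulrDl mulrC ltW.
Qed.

Lemma ccontD {R : realType} (f g : R[i] -> R[i]) z :
  ccont f z -> ccont g z -> ccont (fun w => f w + g w) z.
Proof.
move=> cf cg e e0; have e20 : 0 < e / 2 by rewrite divr_gt0.
have [d1 d10 H1] := cf _ e20; have [d2 d20 H2] := cg _ e20.
exists (Num.min d1 d2); first by rewrite lt_min d10.
move=> w; rewrite lt_min => /andP[/H1 h1 /H2 h2].
rewrite opprD addrACA; apply: le_trans (cmodD _ _) _; lra.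
Qed.

Lemma ccontM {R : realType} (f g : R[i] -> R[i]) z :
  ccont f z -> ccont g z -> ccont (fun w => f w * g w) z.
Proof.
move=> cf cg e e0.
have F0 := cmod_ge0 (f z); have G0 := cmod_ge0 (g z).
have p1 : 0 < e / 2 / (1 + cmod (g z)) by rewrite !divr_gt0// ltr_pwDl.
have p2 : 0 < Num.min 1 (e / 2 / (1 + cmod (f z))).
  by rewrite lt_min ltr01 !divr_gt0// ltr_pwDl.
have [d1 d10 H1] := cf _ p1; have [d2 d20 H2] := cg _ p2.
exists (Num.min d1 d2); first by rewrite lt_min d10.
move=> w; rewrite lt_min => /andP[/H1 h1 /H2].
rewrite le_min => /andP[g1 h2].
have -> : f w * g w - f z * g z = (f w - f z) * g w + f z * (g w - g z) by ring.
apply: le_trans (cmodD _ _) _; rewrite !cmodM.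
have gw : cmod (g w) <= 1 + cmod (g z).
  by rewrite -[g w](subrK (g z)); apply: le_trans (cmodD _ _) _; rewrite lerD2r.
have q1 : cmod (f w - f z) * cmod (g w) <= e / 2.
  rewrite -(divfK (_ : 1 + cmod (g z) != 0) (e / 2)); last first.
    by rewrite gt_eqF// ltr_pwDl.
  by apply: ler_pM; rewrite ?cmod_ge0.
have q2 : cmod (f z) * cmod (g w - g z) <= e / 2.
  rewrite mulrC -(divfK (_ : 1 + cmod (f z) != 0) (e / 2)); last first.
    by rewrite gt_eqF// ltr_pwDl.
  by apply: ler_pM; rewrite ?cmod_ge0// lerDr.
lra.
Qed.

Lemma derivable_ccst {R : realType} (c : R[i]) (z : R[i]^o) :
  derivable ((fun=> c) : R[i]^o -> R[i]^o) z 1.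
Proof. exact: derivable_cst. Qed.

Lemma ccont_cst {R : realType} (c z : R[i]) : ccont (fun=> c) z.
Proof. exact/derivable_ccont/derivable_ccst. Qed.

Lemma derivable_subc {R : realType} (c : R[i]) (z : R[i]^o) :
  derivable ((fun w => w - c) : R[i]^o -> R[i]^o) z 1.
Proof. by apply: derivableB; [exact: derivable_id|exact: derivable_cst]. Qed.

Lemma derivable_cM {R : realType} (f g : R[i]^o -> R[i]^o) (z : R[i]^o) :
  derivable f z 1 -> derivable g z 1 ->
  derivable ((fun w => f w * g w) : R[i]^o -> R[i]^o) z 1.
Proof. by move=> df dg; exact: (@derivableM R[i] R[i]^o f g z 1 df dg). Qed.

Lemma derivable_cD {R : realType} (f g : R[i]^o -> R[i]^o) (z : R[i]^o) :
  derivable f z 1 -> derivable g z 1 ->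
  derivable ((fun w => f w + g w) : R[i]^o -> R[i]^o) z 1.
Proof. by move=> df dg; exact: (@derivableD R[i] R[i]^o R[i]^o f g z 1 df dg). Qed.

Lemma derivable_cV {R : realType} (f : R[i]^o -> R[i]^o) (z : R[i]^o) :
  f z != 0 -> derivable f z 1 ->
  derivable ((fun w => (f w)^-1) : R[i]^o -> R[i]^o) z 1.
Proof. by move=> fz df; exact: (@derivableV R[i] R[i]^o f z 1 fz df). Qed.

(** * Complex differentiable functions in log-polar coordinates *)

(** The exponential of [x + iy]. *)
Definition cexp {R : realType} (x y : R) : R[i] :=
  (expR x * cos y) +i* (expR x * sin y).

Section cexp.
Context {R : realType}.
Implicit Types x y : R.

Lemma cexpD x y x' y' : cexp (x + x') (y + y') = cexp x y * cexp x' y'.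
Proof.
apply/eqP; rewrite eq_complex; apply/andP; split; apply/eqP;
  rewrite ?cReM ?cImM /= expRD ?cosD ?sinD; ring.
Qed.

Lemma cmod_cexp x y : cmod (cexp x y) = expR x.
Proof.
rewrite /cexp /= !exprMn -mulrDr cos2Dsin2 mulr1 sqrtr_sqr.
by rewrite ger0_norm// expR_ge0.
Qed.

Lemma is_derive_lin (f : R -> R) (l : R) : is_derive (0 : R) (1 : R) f l ->
  forall e : R, 0 < e -> exists2 d : R, 0 < d &
    forall y, `|y| < d -> `|f y - f 0 - l * y| <= e * `|y|.
Proof.
move=> df e e0.
have [d d0 Hd] := @derivable_lin R f 0 (@ex_derive _ _ _ _ _ _ _ df) e e0.
exists d => // y yd; have := Hd y; rewrite subr0 => /(_ yd).
by rewrite (@derive_val _ _ _ _ _ _ _ df).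
Qed.

(** The derivative of the complex exponential at 0 is 1; by the addition formula
    [cexpD] this one estimate gives the derivative everywhere. *)
Lemma cexp_small (e : R) : 0 < e -> exists2 d : R, 0 < d &
  forall x y, `|x| < d -> `|y| < d ->
    cmod (cexp x y - 1 - (x +i* y)) <= e * (`|x| + `|y|).
Proof.
move=> e0; have [f [f0 f1 fe]] : exists f, [/\ 0 < f, f <= 1 & f <= e / 8].
  exists (Num.min 1 (e / 8)).
  by split; rewrite ?lt_min ?ltr01 ?divr_gt0// ge_min lexx ?orbT.
have [d1 d10 H1] := is_derive_lin (is_derive_expR (0 : R)) f0.
have [d2 d20 H2] := is_derive_lin (is_derive_cos (0 : R)) f0.
have [d3 d30 H3] := is_derive_lin (is_derive_sin (0 : R)) f0.
exists (Num.min (Num.min d1 f) (Num.min d2 d3)).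
  by rewrite !lt_min d10 d20 d30 f0.
move=> x y; rewrite !lt_min => /andP[/andP[x1 xf] /andP[_ _]].
move=> /andP[/andP[_ _] /andP[y2 y3]].
move: (H1 _ x1) (H2 _ y2) (H3 _ y3).
rewrite expR0 cos0 sin0 !(oppr0, mul0r, addr0, mul1r).
set X := `|x| in xf *; set Y := `|y|.
have X0 : 0 <= X by exact: normr_ge0.
have Y0 : 0 <= Y by exact: normr_ge0.
have fX : f * X <= X by rewrite ler_piMl.
have fY : f * Y <= Y by rewrite ler_piMl.
move=> h1 h2 h3.
have ex1 : `|expR x - 1| <= 2 * f.
  have -> : expR x - 1 = (expR x - 1 - x) + x by ring.
  by apply: le_trans (ler_normD _ _) _; rewrite -/X; lra.
have sy : `|sin y| <= 2 * Y.
  have -> : sin y = (sin y - y) + y by ring.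
  by apply: le_trans (ler_normD _ _) _; rewrite -/Y; lra.
have cy : `|cos y| <= 1 by rewrite ler_norml cos_le1 cos_geN1.
have p1 : `|(expR x - 1 - x) * cos y| <= f * X.
  by rewrite normrM -[leRHS]mulr1 ler_pM.
have p2 : `|(1 + x) * (cos y - 1)| <= 2 * (f * Y).
  rewrite normrM ler_pM//; apply: le_trans (ler_normD _ _) _.
  by rewrite normr1 -/X; lra.
have p3 : `|(expR x - 1) * sin y| <= (2 * f) * (2 * Y) by rewrite normrM ler_pM.
apply: le_trans (cmod_le_ReIm _) _.
rewrite !(cReD, cImD, cReN, cImN) /= oppr0 addr0.
have -> : expR x * cos y - 1 - x =
    (expR x - 1 - x) * cos y + (1 + x) * (cos y - 1) by ring.
have -> : expR x * sin y - y = (expR x - 1) * sin y + (sin y - y) by ring.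
apply: le_trans (lerD (ler_normD _ _) (ler_normD _ _)) _.
have hX : f * X <= e / 8 * X by rewrite ler_wpM2r.
have hY : f * Y <= e / 8 * Y by rewrite ler_wpM2r.
have eX : 0 <= e * X by rewrite mulr_ge0  ?(ltW e0).
have eY : 0 <= e * Y by rewrite mulr_ge0 ?(ltW e0).
lra.
Qed.

Lemma cexp_lin x y (e : R) : 0 < e -> exists2 d : R, 0 < d &
  forall x' y', `|x' - x| < d -> `|y' - y| < d ->
    cmod (cexp x' y' - cexp x y - cexp x y * ((x' - x) +i* (y' - y)))
      <= e * (`|x' - x| + `|y' - y|).
Proof.
move=> e0; have [d d0 Hd] := cexp_small (divr_gt0 e0 (expR_gt0 x)).
exists d => // x' y' xd yd.
have -> : cexp x' y' = cexp x y * cexp (x' - x) (y' - y).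
  by rewrite -cexpD !(addrC _ (_ - _)) !subrK.
set z := _ +i* _; rewrite -{2}[cexp x y]mulr1 -!mulrBr cmodM cmod_cexp mulrC.
by rewrite -ler_pdivlMr ?expR_gt0// mulrAC; exact: Hd.
Qed.

(** For [g = f (c + exp (x + iy))], the Cauchy-Riemann equations say that
    [Im (g dz) = Im g dx + Re g dy] is closed. *)
Lemma closed_form_polar (f : R[i]^o -> R[i]^o) (c : R[i]) x y :
  derivable f (c + cexp x y) 1 ->
  closed_form_at (fun x y => complex.Im (f (c + cexp x y)))
            (fun x y => complex.Re (f (c + cexp x y))) x y.
Proof.
move=> /cderivable_lin [l H]; have [L EL] : exists L, L = l * cexp x y by eexists.
exists (complex.Im L), (complex.Re L), (- complex.Im L) => e e0.
set k := expR x.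
have k0 : 0 < k by exact: expR_gt0.
pose e1 := e / 2 / (k + 1).
have e10 : 0 < e1 by rewrite !divr_gt0// addr_gt0.
have l1 : 0 < cmod l + 1 by rewrite ltr_wpDl// cmod_ge0.
have [e2 [e20 e21 e2l]] : exists e2,
    [/\ 0 < e2, e2 <= 1 & e2 <= e / 2 / (cmod l + 1)].
  exists (Num.min 1 (e / 2 / (cmod l + 1))).
  by split; rewrite ?lt_min ?ltr01 ?divr_gt0// ge_min lexx ?orbT.
have [d1 d10 H1] := H _ e10.
have [d2 d20 H2] := cexp_lin x y e20.
have k1 : 0 < 2 * (k + 1) by rewrite mulr_gt0// addr_gt0.
exists (Num.min d2 (d1 / (2 * (k + 1)))); first by rewrite lt_min d20 divr_gt0.
move=> x' y'; rewrite !lt_min !ltr_pdivlMr// => /andP[x2 x1] /andP[y2 y1].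
set X := x' - x; set Y := y' - y; set S := `|X| + `|Y|.
have S0 : 0 <= S by rewrite addr_ge0.
set w := cexp x y; set w' := cexp x' y'.
have hw : cmod (w' - w - w * (X +i* Y)) <= e2 * S by exact: H2.
have hw' : cmod (w' - w) <= (k + 1) * S.
  rewrite -[w' - w](subrK (w * (X +i* Y))).
  apply: le_trans (cmodD _ _) _; rewrite cmodM /w cmod_cexp -/k mulrDl addrC mul1r.
  apply: lerD; first by rewrite ler_pM2l//; exact: cmod_le_ReIm.
  by apply: le_trans hw _; rewrite ler_piMl.
have hd : cmod ((c + w') - (c + w)) < d1.
  have -> : c + w' - (c + w) = w' - w by ring.
  apply: le_lt_trans hw' _; rewrite /S mulrDr -/X -/Y in x1 y1 *; lra.
have key : cmod (f (c + w') - f (c + w) - L * (X +i* Y)) <= e * S.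
  have -> : f (c + w') - f (c + w) - L * (X +i* Y) =
    (f (c + w') - f (c + w) - l * (c + w' - (c + w))) +
      l * (w' - w - w * (X +i* Y)) by rewrite EL -/w; ring.
  apply: le_trans (cmodD _ _) _.
  have -> : e * S = e / 2 * S + e / 2 * S by field.
  apply: lerD.
    apply: le_trans (H1 _ hd) _.
    have -> : c + w' - (c + w) = w' - w by ring.
    rewrite /e1 -mulrA ler_pM2l ?divr_gt0// mulrC ler_pdivrMr ?addr_gt0//.
    by rewrite mulrC.
  rewrite cmodM; apply: le_trans (ler_wpM2l (cmod_ge0 l) hw) _.
  rewrite mulrA; apply: ler_wpM2r => //.
  apply: (@le_trans _ _ (cmod l * (e / 2 / (cmod l + 1)))).
    by apply: ler_wpM2l; rewrite ?cmod_ge0.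
  by rewrite mulrA ler_pdivrMr// mulrC ler_pM2l ?divr_gt0// lerDl.
split; apply: le_trans key.
  apply: le_trans _ (Im_le_cmod _).
  by rewrite !(cImD, cImN) cImM /= (addrC (_ * Y)).
apply: le_trans _ (Re_le_cmod _).
by rewrite !(cReD, cReN) cReM /= mulNr.
Qed.

End cexp.

Section log_polar_max.
Context {R : realType}.

Lemma cexp_2pi (x : R) : cexp x (0 + pi *+ 2) = cexp x 0.
Proof. by rewrite /cexp add0r cos2pi sin2pi cos0 sin0. Qed.

(** The mean of [Re f] over the circle of radius [exp x] around [c] does not depend
    on [x]: this is [goursat_rect] on [[x1, x0] x [0, 2 pi]], whose two horizontal
    sides cancel by periodicity.  For [x] tending to minus infinity the mean tends
    to [Re (f c)] by continuity at [c].  A quadratic strict maximum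
    at [c] would make the mean over a fixed circle strictly smaller.  The quadratic
    term replaces the discussion of the case of equality in the mean value
    property. *)
Lemma no_strict_max (f : R[i]^o -> R[i]^o) (c : R[i]) (rho eta : R) :
  0 < rho -> 0 < eta ->
  (forall z, z != c -> cmod (z - c) < rho -> derivable f z 1) ->
  ccont f c ->
  ~ (forall z, cmod (z - c) < rho ->
       complex.Re (f z) <= complex.Re (f c) - eta * cmod (z - c) ^+ 2).
Proof.
move=> rho0 eta0 df cf H.
have [r2 r2E] : exists r, r = rho / 2 by eexists.
have r20 : 0 < r2 by rewrite r2E divr_gt0.
pose e := eta * r2 ^+ 2 / 2.
have e0 : 0 < e by rewrite divr_gt0// mulr_gt0// exprn_gt0.
have [d d0 Hd] := cf e e0.
pose d' := Num.min d rho / 2.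
have d'0 : 0 < d' by rewrite divr_gt0// lt_min d0.
have d'd : d' < d.
  by rewrite /d' ltr_pdivrMr// (@le_lt_trans _ _ d)// ?ge_min ?lexx//; lra.
have d'r : d' <= r2 by rewrite r2E ler_pM2r ?invr_gt0// ge_min lexx orbT.
pose x0 := ln r2; pose x1 := ln d'.
have E0 : expR x0 = r2 by rewrite lnK// posrE.
have E1 : expR x1 = d' by rewrite lnK// posrE.
have x10 : 0 <= x0 - x1 by rewrite subr_ge0 ler_ln ?posrE.
have dist x y : cmod (c + cexp x y - c) = expR x.
  by rewrite addrAC subrr add0r cmod_cexp.
pose P x y := complex.Im (f (c + cexp x y)).
pose Q x y := complex.Re (f (c + cexp x y)).
have PQ : closed_form_on P Q x1 (x1 + (x0 - x1)) 0 (0 + pi *+ 2).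
  move=> x y /andP[_ xx0] _; apply: closed_form_polar; apply: df.
    by rewrite -subr_eq0 -cmod_eq0 dist gt_eqF// expR_gt0.
  rewrite dist (@le_lt_trans _ _ (expR x0))//; last by rewrite E0 r2E; lra.
  by rewrite ler_expR; lra.
have pi2 : 0 < pi *+ 2 :> R by rewrite mulrn_wgt0// pi_gt0.
have := goursat_rect x10 (ltW pi2) PQ.
rewrite /rect_int (addrC x1) subrK add0r.
have cst (k : R) u v : cont_on (fun=> k) u v by move=> x _; exact: cvg_cst.
have -> : (fun x => P x 0 - P x (pi *+ 2)) = (fun=> 0).
  by apply/funext => x; rewrite /P -(add0r (pi *+ 2)) cexp_2pi subrr.
rewrite seg_int_cst ?mul0r ?add0r; last by lra.
rewrite (addrC x1) subrK add0r in PQ.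
apply/eqP; rewrite lt_eqF//.
apply: (@le_lt_trans _ _ (seg_int (fun=> - e) 0 (pi *+ 2))).
  apply: seg_int_le => //.
    by apply: cont_onB; apply: closed_form_contQ PQ _; rewrite ?lexx; lra.
  move=> y _; have := H (c + cexp x0 y); rewrite dist E0 r2E => /(_ _)/wrap[].
    by lra.
  have := Hd (c + cexp x1 y); rewrite dist E1 => /(_ d'd) h1 h2.
  have : `|complex.Re (f (c + cexp x1 y)) - complex.Re (f c)| <= e.
    by rewrite -cReN -cReD; exact: le_trans (Re_le_cmod _) h1.
  rewrite ler_norml /Q /e => /andP[h3 _]; rewrite r2E in h3 *; lra.
by rewrite seg_int_cst ?(ltW pi2)// subr0 mulNr oppr_lt0 mulr_gt0.
Qed.

End log_polar_max.

(** * The maximum principle *)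

(** Squares rather than discs: their compactness is that of a product of two
    segments. *)
Definition closed_square {R : realType} (rho : R) (z : R[i]) : Prop :=
  `|complex.Re z| <= rho /\ `|complex.Im z| <= rho.

Definition open_square {R : realType} (rho : R) (z : R[i]) : Prop :=
  `|complex.Re z| < rho /\ `|complex.Im z| < rho.

Section max_square.
Context {R : realType}.

Lemma closed_square_EVT (W : R[i] -> R) (rho : R) : 0 < rho ->
  (forall z, closed_square rho z -> forall e : R, 0 < e -> exists2 d : R, 0 < d &
     forall w, cmod (w - z) < d -> `|W w - W z| <= e) ->
  exists2 c, closed_square rho c & forall z, closed_square rho z -> W z <= W c.
Proof.
move=> rho0 cW.
pose K : set (R * R) := `[- rho, rho] `*` `[- rho, rho].
have KE (x y : R) : K (x, y) <-> closed_square rho (x +i* y).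
  by rewrite /K /closed_square /= !in_itv /= -!ler_norml; split=> -[].
have [|||[a b] + Hc] := @compact_EVT_max (R * R)%type R
    (fun p => W (p.1 +i* p.2)) K.
- by exists (0, 0); apply/KE; rewrite /closed_square /= normr0 ltW.
- by apply: compact_setX; exact: segment_compact.
- apply: continuous_in_subspaceT => -[x y]; rewrite inE => /KE Kxy.
  apply/cvgrPdist_le => e e0; have [d d0 Hd] := cW _ Kxy _ e0.
  have d20 : 0 < d / 2 by rewrite divr_gt0.
  exists (ball x (d / 2), ball y (d / 2)).
    by split; exact: nbhsx_ballx.
  move=> [x' y'] [] /=; rewrite /ball /= => hx hy.
  rewrite distrC; apply: Hd; apply: le_lt_trans (cmod_le_ReIm _) _.
  rewrite /= (distrC x') (distrC y'); lra.
- rewrite inE => /KE Kc; exists (a +i* b) => // -[x y] /KE Kxy.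
  by have := Hc (x, y); rewrite inE => /(_ Kxy).
Qed.

Lemma exceptional_radius (s : seq R[i]) (c : R[i]) : exists2 r : R, 0 < r &
  forall z, z != c -> cmod (z - c) < r -> z \notin s.
Proof.
elim: s => [|a s [r r0 IH]]; first by exists 1.
have [->|ac] := eqVneq a c.
  by exists r => // z zc zr; rewrite inE negb_or zc IH.
exists (Num.min r (cmod (a - c))); first by rewrite lt_min r0 cmod_gt0 subr_eq0.
move=> z zc; rewrite lt_min => /andP[zr za]; rewrite inE negb_or IH// andbT.
by apply: contraTneq za => ->; rewrite ltxx.
Qed.

(** [s] lists possible singularities, where continuity suffices.  If [|f|] exceeded
    its boundary bound at [z0], then [W = |f| + eta |z|^2] with a small [eta] would
    have its maximum at an interior point [c].  After multiplication of [f] by a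
    unimodular [e] with [e f(c) = |f(c)|] and addition of the linear term
    [2 eta conj(c) (z - c)], this becomes a quadratic strict maximum of the real part
    of a holomorphic function, because
    [|z|^2 = |c|^2 + 2 Re (conj(c) (z - c)) + |z - c|^2]. *)
Lemma max_square (f : R[i]^o -> R[i]^o) (s : seq R[i]) (rho M : R) :
  0 < rho ->
  (forall z, closed_square rho z -> ccont f z) ->
  (forall z, open_square rho z -> z \notin s -> derivable f z 1) ->
  (forall z, closed_square rho z -> ~ open_square rho z -> cmod (f z) <= M) ->
  forall z, closed_square rho z -> cmod (f z) <= M.
Proof.
move=> rho0 cf df fM z0 z0s; rewrite leNgt; apply/negP => Mz0.
have rho20 : 0 < rho ^+ 2 by rewrite exprn_gt0.
have [eta [eta0 etaE]] : exists eta : R,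
    0 < eta /\ eta * (2 * rho ^+ 2) = (cmod (f z0) - M) / 2.
  exists ((cmod (f z0) - M) / (4 * rho ^+ 2)); split.
    by rewrite divr_gt0 ?subr_gt0// mulr_gt0.
  by field; rewrite gt_eqF.
pose W z := cmod (f z) + eta * cmod z ^+ 2.
have sq2 z : closed_square rho z -> cmod z ^+ 2 <= 2 * rho ^+ 2.
  move=> [h1 h2]; rewrite cmod_sqr -(real_normK (num_real (complex.Re z))).
  rewrite -(real_normK (num_real (complex.Im z))) mulr_natl mulr2n.
  by apply: lerD; rewrite ler_pXn2r ?nnegrE// ltW.
have [|c cs Wc] := @closed_square_EVT W rho rho0.
  move=> z zs e e0.
  have [d d0 Hd] := cf z zs (e / 2) ltac:(by rewrite divr_gt0).
  pose k := eta * (1 + 2 * cmod z).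
  have k0 : 0 < k by rewrite mulr_gt0// ltr_pwDl// mulr_ge0// cmod_ge0.
  exists (Num.min (Num.min d 1) (e / 2 / k)).
    by rewrite !lt_min d0 ltr01 !divr_gt0.
  move=> w; rewrite !lt_min ltr_pdivlMr// => /andP[/andP[wd w1] wk].
  have tri (u v : R[i]) : `|cmod u - cmod v| <= cmod (u - v).
    rewrite ler_norml; apply/andP; split.
      have := cmodD (v - u) u; rewrite subrK (cmodBC v); lra.
    have := cmodD (u - v) v; rewrite subrK; lra.
  have -> : W w - W z = (cmod (f w) - cmod (f z)) +
     eta * ((cmod w - cmod z) * (cmod w + cmod z)) by rewrite /W; ring.
  apply: le_trans (ler_normD _ _) _.
  have h1 := le_trans (tri (f w) (f z)) (Hd w wd).
  have h2 := tri w z.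
  have h3 : `|cmod w + cmod z| <= 1 + 2 * cmod z.
    rewrite ger0_norm ?addr_ge0 ?cmod_ge0//.
    by move: h2; rewrite ler_norml => /andP[_ ?]; lra.
  have h4 : `|eta * ((cmod w - cmod z) * (cmod w + cmod z))| <= e / 2.
    rewrite !normrM (gtr0_norm eta0); apply: le_trans (ltW wk).
    rewrite /k [leRHS]mulrCA; apply: ler_wpM2l; first exact: ltW.
    by apply: ler_pM.
  by lra.
have W0 : W z0 <= W c by exact: Wc.
have co : open_square rho c.
  apply: contrapT => nco; have := fM c cs nco; have := sq2 c cs.
  rewrite -(ler_pM2l eta0) etaE; move: W0; rewrite /W.
  have : 0 <= eta * cmod z0 ^+ 2 by rewrite mulr_ge0 ?exprn_ge0 ?cmod_ge0// ltW.
  by lra.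
have [e [e1 ec]] : exists e : R[i], cmod e = 1 /\ e * f c = (cmod (f c))%:C.
  have [f0|f0] := eqVneq (f c) 0.
    by exists 1; rewrite cmod1 f0 mulr0 cmod0.
  exists ((cmod (f c))%:C / f c); rewrite cmodM cmodV cmod_real divfK//.
  by rewrite ger0_norm ?cmod_ge0// divff// cmod_eq0.
pose g := (fun z => e * f z + (2 * eta)%:C * (c^* * (z - c))) : R[i]^o -> R[i]^o.
have [r1 r10 Hr1] := exceptional_radius s c.
pose r2 := Num.min (rho - `|complex.Re c|) (rho - `|complex.Im c|).
have r20 : 0 < r2 by rewrite lt_min !subr_gt0; case: co => -> ->.
have inball z : cmod (z - c) < r2 -> open_square rho z.
  rewrite lt_min => /andP[hx hy]; split.
    have -> : complex.Re z = complex.Re c + complex.Re (z - c).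
      by rewrite -cReD addrC subrK.
    by apply: le_lt_trans (ler_normD _ _) _; have := Re_le_cmod (z - c); lra.
  have -> : complex.Im z = complex.Im c + complex.Im (z - c).
    by rewrite -cImD addrC subrK.
  by apply: le_lt_trans (ler_normD _ _) _; have := Im_le_cmod (z - c); lra.
have r0 : 0 < Num.min r1 r2 by rewrite lt_min r10.
apply: (@no_strict_max R g c (Num.min r1 r2) eta r0 eta0).
- move=> z zc; rewrite lt_min => /andP[zr1 zr2].
  apply: derivable_cD; apply: derivable_cM.
  - exact: derivable_ccst.
  - by apply: df; [exact: inball|exact: Hr1].
  - exact: derivable_ccst.
  - by apply: derivable_cM; [exact: derivable_ccst|exact: derivable_subc].
- apply: ccontD; apply: ccontM; try exact: ccont_cst.
    exact: cf.
  by apply: ccontM; [exact: ccont_cst|exact/derivable_ccont/derivable_subc].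
- move=> z; rewrite lt_min => /andP[_ /inball zo].
  have zs : closed_square rho z by case: zo => ? ?; split; exact: ltW.
  have := Wc z zs; rewrite /g subrr !mulr0 addr0 ec /= /W.
  have : complex.Re (e * f z) <= cmod (f z).
    by apply: le_trans (Re_le _) _; rewrite cmodM e1 mul1r.
  have -> : cmod z ^+ 2 = cmod c ^+ 2 + 2 * complex.Re (c^* * (z - c)) + cmod (z - c) ^+ 2.
    rewrite !cmod_sqr; case: (c) (z) => [a b] [x y] /=.
    by ring.
  rewrite !cReD cReZ.
  by lra.
Qed.

End max_square.

(** * Difference quotients and the Schwarz lemma *)

(** The value at [a] is the one that makes the quotient continuous there. *)
Definition diff_quot {R : realType} (f : R[i]^o -> R[i]^o) (a : R[i]^o) :
    R[i]^o -> R[i]^o :=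
  fun z => if z == a then 'D_1 f a else (f z - f a) * (z - a)^-1.

(** The class to which [max_square] applies.  Unlike differentiability, it is stable
    under difference quotients, at the price of one more exceptional point. *)
Definition holo_off {R : realType} (s : seq R[i]) (rho : R)
    (f : R[i]^o -> R[i]^o) : Prop :=
  (forall z, closed_square rho z -> ccont f z) /\
  (forall z, open_square rho z -> z \notin s -> derivable f z 1).

Section diff_quot.
Context {R : realType}.
Implicit Types (f g : R[i]^o -> R[i]^o) (a z w : R[i]).

Lemma derivable_linD f z : derivable f z 1 ->
  forall e : R, 0 < e -> exists2 d : R, 0 < d &
    forall w, cmod (w - z) < d ->
      cmod (f w - f z - 'D_1 f z * (w - z)) <= e * cmod (w - z).
Proof.
move=> /derivable_lin H e e0.
have [|d /cpos_real[r r0 ->] Hr] := H e%:C; first by rewrite ltcR.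
exists r => // w wz; rewrite -lecR rmorphM -!cmodE; apply: Hr.
by rewrite ltc_cmod.
Qed.

Lemma ccont_local f g z (r : R) : 0 < r ->
  (forall w, cmod (w - z) < r -> f w = g w) -> ccont g z -> ccont f z.
Proof.
move=> r0 fg cg e e0; have [d d0 Hd] := cg e e0.
exists (Num.min r d); first by rewrite lt_min r0.
move=> w; rewrite lt_min => /andP[wr wd]; rewrite !fg ?subrr ?cmod0//.
exact: Hd.
Qed.

Lemma derivable_local f g z (r : R) : 0 < r ->
  (forall w, cmod (w - z) < r -> f w = g w) ->
  derivable g z 1 -> derivable f z 1.
Proof.
move=> r0 fg /cderivable_lin [l H]; apply: (@lin_cderivable _ _ _ l) => e e0.
have [d d0 Hd] := H e e0.
exists (Num.min r d); first by rewrite lt_min r0.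
move=> w; rewrite lt_min => /andP[wr wd]; rewrite !fg ?subrr ?cmod0//.
exact: Hd.
Qed.

Lemma diff_quotE f a z : z != a -> diff_quot f a z = (f z - f a) * (z - a)^-1.
Proof. by rewrite /diff_quot => /negbTE ->. Qed.

Lemma diff_quotM f a z : f z = f a + diff_quot f a z * (z - a).
Proof.
have [->|za] := eqVneq z a; first by rewrite subrr mulr0 addr0.
by rewrite diff_quotE// divfK ?subr_eq0// addrC subrK.
Qed.

Lemma diff_quot_near f a z : z != a -> forall w, cmod (w - z) < cmod (z - a) ->
  diff_quot f a w = (f w - f a) * (w - a)^-1.
Proof.
move=> za w wz; rewrite diff_quotE//; apply: contraTneq wz => ->.
by rewrite cmodBC ltxx.
Qed.

Lemma derivable_invsub a z : z != a ->
  derivable ((fun w => (w - a)^-1) : R[i]^o -> R[i]^o) z 1.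
Proof.
move=> za; apply: derivable_cV; last exact: derivable_subc.
by rewrite subr_eq0.
Qed.

Lemma diff_quot_derivable f a z : z != a -> derivable f z 1 ->
  derivable (diff_quot f a) z 1.
Proof.
move=> za df; have r0 : 0 < cmod (z - a) by rewrite cmod_gt0 subr_eq0.
apply: (derivable_local r0 (diff_quot_near f za)).
apply: derivable_cM.
  by apply: derivable_cD; [exact: df|exact: derivable_ccst].
exact: derivable_invsub.
Qed.

Lemma diff_quot_ccont f a z : z != a -> ccont f z -> ccont (diff_quot f a) z.
Proof.
move=> za cf; have r0 : 0 < cmod (z - a) by rewrite cmod_gt0 subr_eq0.
apply: (ccont_local r0 (diff_quot_near f za)).
apply: ccontM; first by apply: ccontD => //; exact: ccont_cst.
exact/derivable_ccont/derivable_invsub.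
Qed.

Lemma diff_quot_ccont_at f a : derivable f a 1 -> ccont (diff_quot f a) a.
Proof.
move=> df e e0; have [d d0 Hd] := derivable_linD df e0.
exists d => // w wa; rewrite {2}/diff_quot eqxx.
have [->|nwa] := eqVneq w a; first by rewrite /diff_quot eqxx subrr cmod0 ltW.
rewrite diff_quotE//; have nz : w - a != 0 by rewrite subr_eq0.
rewrite -(ler_pM2r (_ : 0 < cmod (w - a))) ?cmod_gt0// -cmodM.
by rewrite mulrBl divfK//; exact: Hd.
Qed.

Lemma diff_quot_holo_off s (rho : R) f a : open_square rho a -> a \notin s ->
  holo_off s rho f -> holo_off (a :: s) rho (diff_quot f a).
Proof.
move=> ao as_ [cf df]; split=> z zr.
  have [->|za] := eqVneq z a; first by apply: diff_quot_ccont_at; exact: df.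
  by apply: diff_quot_ccont => //; exact: cf.
rewrite inE negb_or => /andP[za zs].
by apply: diff_quot_derivable => //; exact: df.
Qed.

(** Only the boundary of the square matters, and there [|z| >= rho]. *)
Lemma holo_off_bound s (rho M : R) f : 0 < rho -> holo_off s rho f ->
  (forall z, closed_square rho z -> rho <= cmod z -> cmod (f z) <= M) ->
  forall z, closed_square rho z -> cmod (f z) <= M.
Proof.
move=> rho0 [cf df] fM; apply: (@max_square _ f s) => // z zc zo.
apply: fM => //; rewrite leNgt; apply/negP => zr; apply: zo; split.
  exact: le_lt_trans (Re_le_cmod z) zr.
exact: le_lt_trans (Im_le_cmod z) zr.
Qed.

(** The Schwarz lemma in the form that can be iterated at several points: on the
    boundary of the square [|z - a| >= rho / 2]. *)
Lemma diff_quot_bound s (rho M : R) f a : 0 < rho -> cmod a <= rho / 2 ->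
  a \notin s -> holo_off s rho f ->
  (forall z, closed_square rho z -> cmod (f z) <= M) ->
  forall z, closed_square rho z -> cmod (diff_quot f a z) <= 4 * M / rho.
Proof.
move=> rho0 ar as_ hf fM.
have ao : open_square rho a.
  by split; [have := Re_le_cmod a|have := Im_le_cmod a]; lra.
have ac : closed_square rho a by case: ao => ? ?; split; exact: ltW.
have M0 : 0 <= M by apply: le_trans (fM _ ac); exact: cmod_ge0.
apply: (holo_off_bound rho0 (diff_quot_holo_off ao as_ hf)) => z zc zr.
have h1 : rho / 2 <= cmod (z - a).
  by have := cmodD (z - a) a; rewrite subrK; lra.
have za0 : 0 < cmod (z - a) by apply: lt_le_trans h1; rewrite divr_gt0.
have za : z != a by rewrite -subr_eq0 -cmod_gt0.
rewrite diff_quotE// cmodM cmodV ler_pdivrMr//.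
apply: (@le_trans _ _ (M + M)).
  by apply: le_trans (cmodB _ _) _; apply: lerD; exact: fM.
have -> : M + M = 4 * M / rho * (rho / 2) by field; rewrite gt_eqF.
by apply: ler_wpM2l => //; rewrite divr_ge0 ?mulr_ge0// ltW.
Qed.

Lemma derivable_holo_off (rho : R) f : (forall z, closed_square rho z -> derivable f z 1) ->
  holo_off [::] rho f.
Proof.
move=> df; split=> z; first by move=> /df/derivable_ccont.
by move=> [? ?] _; apply: df; split; exact: ltW.
Qed.

Lemma cmod_closed_square (rho : R) z : cmod z <= rho -> closed_square rho z.
Proof.
by move=> zr; split; apply: le_trans zr; [exact: Re_le_cmod|exact: Im_le_cmod].
Qed.

(** With [A = eps + B], the Cayley transform [(F - A) / (F + A)] of [F = f + B]
    maps the square into the unit disc and sends 0 to 0, so the Schwarz lemma bounds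
    its value at [alpha], which is [(delta - eps) / (delta + eps + 2 B)].  The
    constant 16 is [4 * 4]: the first from [diff_quot_bound], the second from
    [delta + eps + 2 B <= 4 B]. *)
Lemma halfplane_schwarz f (rho B eps delta : R) alpha : 0 < rho ->
  (forall z, closed_square rho z -> derivable f z 1) ->
  (forall z, closed_square rho z -> - B <= complex.Re (f z)) ->
  f 0 = eps%:C -> f alpha = delta%:C -> 0 < delta -> delta < eps -> eps <= B ->
  (eps - delta) * rho <= 16 * B * cmod alpha.
Proof.
move=> rho0 df fB f0 fa d0 de eB.
have B0 : 0 < B by lra.
(* If [alpha] is too far from 0 for the Schwarz lemma, the inequality is trivial. *)
have [ra|ra] := leP rho (cmod alpha).
  apply: (@le_trans _ _ (B * cmod alpha)); first by apply: ler_pM; lra.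
  have : 0 <= B * cmod alpha by rewrite mulr_ge0 ?cmod_ge0// ltW.
  by lra.
have [A [A0 AE]] : exists A, 0 < A /\ A = eps + B by exists (eps + B); split; lra.
pose g : R[i]^o -> R[i]^o := fun z => (f z + (B - A)%:C) * (f z + (B + A)%:C)^-1.
have re z (k : R) : complex.Re (f z + k%:C) = complex.Re (f z) + k.
  by rewrite cReD.
have im z (k : R) : complex.Im (f z + k%:C) = complex.Im (f z).
  by rewrite cImD /= addr0.
have nz z : closed_square rho z -> f z + (B + A)%:C != 0.
  move=> /fB h; apply/eqP => /(congr1 (@complex.Re R)).
  by rewrite re => /= h'; lra.
have dg z : closed_square rho z -> derivable g z 1.
  move=> zc; apply: derivable_cM.
    by apply: derivable_cD; [exact: df|exact: derivable_ccst].
  apply: derivable_cV; first exact: nz.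
  by apply: derivable_cD; [exact: df|exact: derivable_ccst].
have g1 z : closed_square rho z -> cmod (g z) <= 1.
  move=> zc; have n0 : 0 < cmod (f z + (B + A)%:C) by rewrite cmod_gt0 nz.
  rewrite /g cmodM cmodV ler_pdivrMr// mul1r.
  rewrite -(ler_pXn2r (n := 2))// ?nnegrE ?cmod_ge0// !cmod_sqr !re !im lerD2r.
  have := fB z zc => h; rewrite -subr_ge0.
  have -> : (complex.Re (f z) + (B + A)) ^+ 2 - (complex.Re (f z) + (B - A)) ^+ 2
    = 4 * (A * (complex.Re (f z) + B)) by ring.
  by rewrite mulr_ge0// mulr_ge0 ?(ltW A0)//; lra.
have ac : closed_square rho alpha by exact/cmod_closed_square/ltW.
have := @diff_quot_bound [::] rho 1 g 0 rho0 ltac:(by rewrite cmod0 divr_ge0 ?ltW)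
  isT (derivable_holo_off dg) g1 alpha ac.
move=> q; have := diff_quotM g 0 alpha.
have -> : g 0 = 0.
  by rewrite /g f0 -rmorphD (_ : eps + (B - A) = 0) ?mul0r// AE; ring.
rewrite add0r subr0 => /(congr1 (fun z => cmod z)); rewrite cmodM.
rewrite /g fa -!rmorphD cmodM cmodV !cmod_real.
have -> : delta + (B - A) = - (eps - delta) by rewrite AE; ring.
rewrite normrN gtr0_norm ?subr_gt0// gtr0_norm; last by lra.
move=> E; have S0 : 0 < delta + (B + A) by lra.
have E2 : eps - delta = cmod (diff_quot g 0 alpha) * cmod alpha * (delta + (B + A)).
  by rewrite -E divfK// gt_eqF.
rewrite E2.
have -> : 16 * B * cmod alpha = (4 * 1 / rho) * cmod alpha * (4 * B) * rho.
  by field; rewrite gt_eqF.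
rewrite ler_pM2r//; apply: ler_pM; rewrite ?mulr_ge0 ?cmod_ge0//.
- exact: ltW.
- by apply: ler_wpM2r; rewrite ?cmod_ge0.
- lra.
Qed.

End diff_quot.

(** * Taylor expansion of a function with Hoelder gradient *)

(** The Hermitian product; its real part is the Euclidean product of the real
    [2n]-space, the one in which [rgrad] is the gradient. *)
Definition herm {R : realType} {n : nat} (u v : 'rV[R[i]^o]_n) : R[i] :=
  \sum_(j < n) (u 0 j : R[i]) * conjc (v 0 j : R[i]).

Section hermitian.
Context {R : realType} {n : nat}.
Implicit Types (u v w z p : 'rV[R[i]^o]_n).

Lemma rowZE (k : R[i]) z j : (k *: z) 0 j = k * (z 0 j : R[i]) :> R[i].
Proof. by rewrite mxE. Qed.
Lemma rowDE u v j : (u + v) 0 j = (u 0 j : R[i]) + (v 0 j : R[i]) :> R[i].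
Proof. by rewrite mxE. Qed.
Lemma rowBE u v j : (u - v) 0 j = (u 0 j : R[i]) - (v 0 j : R[i]) :> R[i].
Proof. by rewrite !mxE. Qed.

Lemma enorm_ge0 z : 0 <= enorm z. Proof. exact: sqrtr_ge0. Qed.

Lemma cmod_le_enorm z j : cmod (z 0 j) <= enorm z.
Proof.
rewrite -[cmod _]ger0_norm ?cmod_ge0// -sqrtr_sqr /enorm ler_sqrt; last first.
  by apply: sumr_ge0 => k _; exact: sqr_ge0.
by rewrite (bigD1 j)//= lerDl; apply: sumr_ge0 => k _; exact: sqr_ge0.
Qed.

Lemma enorm_le_sum z (m : R) : 0 <= m -> (forall j, cmod (z 0 j) <= m) ->
  enorm z <= n%:R * m.
Proof.
move=> m0 zm; rewrite -[leRHS]ger0_norm ?mulr_ge0// -sqrtr_sqr.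
rewrite ler_wsqrtr// exprMn; apply: (@le_trans _ _ (\sum_(j < n) m ^+ 2)).
  by apply: ler_sum => j _; rewrite ler_pXn2r ?nnegrE ?cmod_ge0.
rewrite sumr_const card_ord -[leLHS]mulr_natl ler_wpM2r ?sqr_ge0//.
by rewrite -natrX ler_nat; case: (n) => // k; rewrite expnS expn1 leq_pmulr.
Qed.

Lemma enormZ (k : R[i]) z : enorm (k *: z) = cmod k * enorm z.
Proof.
rewrite /enorm; under eq_bigr do rewrite rowZE cmodM exprMn.
rewrite -mulr_sumr sqrtrM ?sqr_ge0// sqrtr_sqr.
by rewrite ger0_norm// cmod_ge0.
Qed.

Lemma enorm_eq0 z : enorm z = 0 -> z = 0.
Proof.
move=> z0; apply/rowP => j; rewrite mxE; apply/eqP; rewrite -cmod_eq0.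
by rewrite eq_le cmod_ge0 andbT -z0 cmod_le_enorm.
Qed.

Lemma enorm_gt0 z : z != 0 -> 0 < enorm z.
Proof.
move=> z0; rewrite lt_def enorm_ge0 andbT; apply: contra_neq z0.
exact: enorm_eq0.
Qed.

Lemma hermZl (k : R[i]) u v : herm (k *: u) v = k * herm u v.
Proof. by rewrite mulr_sumr; apply: eq_bigr => j _; rewrite rowZE mulrA. Qed.

Lemma hermBr u v w : herm u (v - w) = herm u v - herm u w.
Proof.
rewrite -sumrB; apply: eq_bigr => j _.
by rewrite rowBE rmorphB mulrBr.
Qed.

Lemma hermZr (k : R[i]) u v : herm u (k *: v) = conjc k * herm u v.
Proof.
rewrite mulr_sumr; apply: eq_bigr => j _; rewrite rowZE.
by rewrite rmorphM mulrCA.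
Qed.

Lemma cmod_conj (z : R[i]) : cmod (conjc z) = cmod z.
Proof. by case: z => a b; rewrite /= sqrrN. Qed.

Lemma herm_self u : herm u u = (enorm u ^+ 2)%:C.
Proof.
rewrite sqr_sqrtr; last by apply: sumr_ge0 => j _; exact: sqr_ge0.
rewrite rmorph_sum; apply: eq_bigr => j _.
rewrite cmod_sqr; case: (u 0 j) => a b; apply/eqP; rewrite eq_complex /=.
by apply/andP; split; apply/eqP; ring.
Qed.

Lemma cmod_sum (m : nat) (F : 'I_m -> R[i]) :
  cmod (\sum_(j < m) F j) <= \sum_(j < m) cmod (F j).
Proof.
elim/big_ind2 : _ => //; first by rewrite cmod0.
by move=> x1 x2 y1 y2 h1 h2; apply: le_trans (cmodD _ _) _; exact: lerD.
Qed.

Lemma cmod_herm u v : cmod (herm u v) <= n%:R * (enorm u * enorm v).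
Proof.
apply: le_trans (cmod_sum _) _.
apply: (@le_trans _ _ (\sum_(j < n) (enorm u * enorm v))).
  apply: ler_sum => j _; rewrite cmodM cmod_conj.
  by apply: ler_pM; rewrite ?cmod_ge0// cmod_le_enorm.
by rewrite sumr_const card_ord mulr_natl.
Qed.

Lemma nbhs_enorm (U : set 'rV[R[i]^o]_n) p : nbhs p U ->
  exists2 d : R, 0 < d & forall z, enorm (z - p) < d -> U z.
Proof.
move=> /nbhs_ballP[e /cpos_real[d d0 ->] Hd]; exists d => // z zd.
apply: Hd; split; first by rewrite ltcR.
move=> i j; rewrite /ball /=.
have -> : i = 0 by apply/val_inj; case: i => -[].
rewrite ltc_cmod; apply: le_lt_trans zd.
by have := cmod_le_enorm (z - p) j; rewrite !mxE cmodBC.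
Qed.

Lemma of_realK : cancel (@to_real R n) of_real.
Proof. by move=> z; apply/rowP => j; rewrite !mxE; case: (z 0 j). Qed.

Lemma to_real_line p v (t : R) :
  to_real (p + t%:C *: v) = to_real p + t *: to_real v.
Proof.
congr (_, _); apply/rowP => j; rewrite ?[LHS]mxE rowDE rowZE !mxE;
  case: (p 0 j) (v 0 j) => a b [c d] /=; ring.
Qed.


(** The differential is linear on the real [2n]-space, so it is determined by the
    partial derivatives that make up [rgrad]. *)
Lemma rdiff_dir (r : 'rV[R[i]^o]_n -> R) w v : rdifferentiable r w ->
  derivable (r \o of_real) (to_real w) (to_real v) /\
  'D_(to_real v) (r \o of_real) (to_real w) =
     complex.Re (herm v (rgrad r w)).
Proof.
move=> df; split; first exact: diff_derivable.
rewrite deriveE//; set L := 'd _ _.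
have L1 (x : 'rV[R]_n) : L (x, 0) =
    \sum_(j < n) x 0 j * L (delta_mx 0 j, 0).
  have -> : (x, 0) = \sum_(j < n) x 0 j *: (delta_mx 0 j, 0) :> 'rV[R]_n * 'rV[R]_n.
    rewrite [RHS]surjective_pairing; congr pair.
      by rewrite (raddf_sum fst) /= -row_sum_delta.
    by rewrite (raddf_sum snd) /= big1// => j _; rewrite scaler0.
  by rewrite linear_sum; apply: eq_bigr => j _; rewrite linearZ.
have L2 (x : 'rV[R]_n) : L (0, x) =
    \sum_(j < n) x 0 j * L (0, delta_mx 0 j).
  have -> : (0, x) = \sum_(j < n) x 0 j *: (0, delta_mx 0 j) :> 'rV[R]_n * 'rV[R]_n.
    rewrite [RHS]surjective_pairing; congr pair.
      by rewrite (raddf_sum fst) /= big1// => j _; rewrite scaler0.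
    by rewrite (raddf_sum snd) /= -row_sum_delta.
  by rewrite linear_sum; apply: eq_bigr => j _; rewrite linearZ.
have -> : to_real v = ((to_real v).1, 0) + (0, (to_real v).2).
  rewrite [RHS]surjective_pairing (raddfD fst) (raddfD snd) /=.
  by rewrite addr0 add0r.
rewrite linearD L1 L2 -big_split.
have reS (m : nat) (F : 'I_m -> R[i]) :
    complex.Re (\sum_(j < m) F j) = \sum_(j < m) complex.Re (F j).
  by elim/big_ind2 : _ => // ? ? ? ? <- <-; rewrite cReD.
rewrite reS; apply: eq_bigr => j _.
rewrite !mxE !deriveE// -/L.
by case: (v 0 j) => a b /=; rewrite mulrN opprK.
Qed.

Lemma rdiff_line (r : 'rV[R[i]^o]_n -> R) p v (t : R) :
  rdifferentiable r (p + t%:C *: v) ->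
  is_derive t 1 (fun s : R => r (p + s%:C *: v))
    (complex.Re (herm v (rgrad r (p + t%:C *: v)))).
Proof.
move=> /(rdiff_dir v)[dv <-].
have K (h : R) : of_real (h *: to_real v + to_real (p + t%:C *: v)) =
    p + (h + t)%:C *: v.
  by rewrite addrC -to_real_line of_realK -addrA -scalerDl -rmorphD (addrC t).
have E : (fun h : R => h^-1 *: (((fun s : R => r (p + s%:C *: v)) \o shift t) (h *: 1) -
     r (p + t%:C *: v))) =
   (fun h : R => h^-1 *: (((r \o of_real) \o shift (to_real (p + t%:C *: v))) (h *: to_real v) -
     (r \o of_real) (to_real (p + t%:C *: v)))).
  apply/funext => h; congr (_ *: (_ - _)); last by rewrite /= of_realK.
  rewrite /= K; congr (r (p + _%:C *: v)); congr (_ + t).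
  exact: mulr1.
split; first by rewrite /derivable E.
by rewrite /derive E.
Qed.

(** The mean value theorem on the segment from [p] to [z], followed by the Hoelder
    condition on the gradient.  The factor [n] comes from a crude form of the
    Cauchy-Schwarz inequality, [cmod_herm]. *)
Lemma taylor (gamma : R) (U : set 'rV[R[i]^o]_n) (r : 'rV[R[i]^o]_n -> R) p :
  0 < gamma -> open U -> U p -> C1gamma_on gamma U r ->
  exists d L : R, [/\ 0 < d, 0 <= L & forall z, enorm (z - p) < d ->
    U z /\ `|r z - r p - complex.Re (herm (z - p) (rgrad r p))|
      <= L * enorm (z - p) `^ (1 + gamma)].
Proof.
move=> gamma0 Uo Up [df [L0 HL]].
have [d d0 Hd] := nbhs_enorm (open_nbhs_nbhs (conj Uo Up)).
exists d, (n%:R * `|L0|); split=> [//||z zd]; first by rewrite mulr_ge0.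
split; first exact: Hd.
set v := z - p in zd *.
have pv : p + v = z by rewrite /v addrC subrK.
have inU (t : R) : 0 <= t <= 1 -> U (p + t%:C *: v) /\
    enorm ((p + t%:C *: v) - p) <= enorm v.
  move=> /andP[t0 t1].
  have -> : p + t%:C *: v - p = t%:C *: v by rewrite addrAC subrr add0r.
  suff h : enorm (t%:C *: v) <= enorm v.
    split=> //; apply: Hd; rewrite addrAC subrr add0r.
    exact: le_lt_trans h zd.
  by rewrite enormZ cmod_real ger0_norm// ler_piMl ?enorm_ge0.
pose g (t : R) := r (p + t%:C *: v).
have dg (t : R) : 0 <= t <= 1 -> is_derive t 1 g
    (complex.Re (herm v (rgrad r (p + t%:C *: v)))).
  by move=> /inU[Ut _]; apply: rdiff_line; exact: df.
have [t t01||t +] := @MVT_segment R g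
    (fun t => complex.Re (herm v (rgrad r (p + t%:C *: v)))) 0 1 ler01.
- by apply: dg; move: t01; rewrite in_itv /= => /andP[/ltW -> /ltW ->].
- apply: derivable_within_continuous => t; rewrite in_itv /= => t01.
  by have [] := dg t t01.
rewrite in_itv /= => t01; rewrite subr0 mulr1 /g.
rewrite rmorph1 rmorph0 scale1r scale0r addr0 pv => ->.
rewrite -cReN -cReD -hermBr; apply: le_trans (Re_le_cmod _) _.
apply: le_trans (cmod_herm _ _) _; rewrite -!mulrA ler_wpM2l//.
have [Ut vt] := inU t t01.
have [->|v0] := eqVneq v 0.
  have -> : enorm (0 : 'rV[R[i]^o]_n) = 0.
    by rewrite -(scale0r 0) enormZ cmod0 mul0r.
  by rewrite mul0r mulr_ge0// powR_ge0.
have ev := enorm_gt0 v0.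
rewrite powRD; last by rewrite (gt_eqF ev) implybT.
rewrite powRr1 ?enorm_ge0// mulrCA ler_wpM2l ?enorm_ge0//.
apply: le_trans (HL _ _ Ut Up) _; apply: le_trans (ler_wpM2r (powR_ge0 _ _) (ler_norm _)) _.
apply: ler_wpM2l; first exact: normr_ge0.
apply: ge0_ler_powR vt; first exact: ltW.
  by rewrite nnegrE enorm_ge0.
by rewrite nnegrE enorm_ge0.
Qed.

End hermitian.

Section vector_valued.
Context {R : realType} {n : nat}.

(** * Holomorphic maps into complex n-space and the square root *)

Lemma derivable_coord (phi : R[i]^o -> 'rV[R[i]^o]_n) (z : R[i]^o) j :
  derivable phi z 1 -> derivable ((fun w => phi w 0 j) : R[i]^o -> R[i]^o) z 1.
Proof.
move=> /cvg_ex[l Hl]; apply/cvg_ex; exists (l 0 j).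
have := cvg_comp _ _ Hl (@coord_continuous R[i] 1 n 0 j l).
suff -> : (fun h => h^-1 *: (((fun w => phi w 0 j) \o shift z) (h *: 1) - phi z 0 j)) =
  ((fun M : 'rV[R[i]^o]_n => M 0 j) \o
    (fun h => h^-1 *: ((phi \o shift z) (h *: 1) - phi z))) by [].
by apply/funext => h; rewrite /= !mxE.
Qed.

Lemma derivable_line (g : R[i]^o -> R[i]^o) (p nu : 'rV[R[i]^o]_n) (z : R[i]^o) :
  derivable g z 1 -> derivable (fun w => p + g w *: nu) z 1.
Proof.
move=> /cvg_ex[l Hl]; apply/cvg_ex; exists (l *: nu).
have FF : Filter ((0 : R[i]^o)^') by exact: dnbhs_filter.
have := @cvgZr_tmp _ _ _ _ FF _ _ nu Hl.
suff -> : (fun h => h^-1 *: (((fun w => p + g w *: nu) \o shift z) (h *: 1) - (p + g z *: nu))) =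
  (fun h => (h^-1 *: ((g \o shift z) (h *: 1) - g z)) *: nu) by [].
apply/funext => h; rewrite /= opprD addrACA subrr add0r -scalerBl scalerA.
by [].
Qed.

(** The principal square root maps the right half-plane into the sector
    [|Im| <= Re], because [Re s ^ 2 - Im s ^ 2] is the real part of [s ^ 2]. *)
Lemma Re_sqrtc (z : R[i]) : 0 < complex.Re z ->
  0 < complex.Re (sqrtc z) /\
  `|complex.Im (sqrtc z)| <= complex.Re (sqrtc z).
Proof.
move=> z0; have Es := sqr_sqrtc z.
have R0 : 0 <= complex.Re (sqrtc z).
  by case: (z) => a b; exact: sqrtr_ge0.
have : complex.Re (sqrtc z) ^+ 2 - complex.Im (sqrtc z) ^+ 2 = complex.Re z.
  by rewrite -[in RHS]Es expr2 cReM.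
move=> E; have I0 := sqr_ge0 (complex.Im (sqrtc z)).
split.
  rewrite lt_def R0 andbT; apply/eqP => r0.
  by move: E; rewrite r0 expr0n/=; lra.
rewrite -(ler_pXn2r (n := 2))// ?nnegrE// real_normK ?num_real//; lra.
Qed.

(** From [w - z = (sqrt w - sqrt z) (sqrt w + sqrt z)], where the second factor is
    bounded away from 0 since both roots have positive real part. *)
Lemma derivable_sqrtc (z : R[i]) : 0 < complex.Re z ->
  derivable ((fun w => sqrtc w) : R[i]^o -> R[i]^o) z 1.
Proof.
move=> z0; have [s0 _] := Re_sqrtc z0.
have [s Es] : exists s, s = complex.Re (sqrtc z) by eexists.
rewrite -Es in s0.
have sz : cmod (sqrtc z) >= s by rewrite Es Re_le.
have nsz : sqrtc z != 0 by rewrite -cmod_gt0; exact: lt_le_trans sz.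
apply: (@lin_cderivable _ _ _ ((2 * sqrtc z)^-1)) => e e0.
exists (Num.min (complex.Re z) (2 * e * s ^+ 3)).
  by rewrite lt_min z0 mulr_gt0 ?exprn_gt0// mulr_gt0.
move=> w; rewrite lt_min => /andP[wz we].
have w0 : 0 < complex.Re w.
  have := Re_le_cmod (w - z); rewrite cReD cReN ler_norml => /andP[? _]; lra.
have [t0 _] := Re_sqrtc w0.
have st : s <= cmod (sqrtc w + sqrtc z).
  by apply: le_trans (Re_le _); rewrite cReD -Es; lra.
have nst : sqrtc w + sqrtc z != 0 by rewrite -cmod_gt0; exact: lt_le_trans st.
have E1 : w - z = (sqrtc w - sqrtc z) * (sqrtc w + sqrtc z).
  by rewrite -{1}(sqr_sqrtc w) -{1}(sqr_sqrtc z); ring.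
have -> : sqrtc w - sqrtc z - (2 * sqrtc z)^-1 * (w - z) =
   - (w - z) * (w - z) / ((sqrtc w + sqrtc z) ^+ 2 * (2 * sqrtc z)).
  by rewrite E1; field; rewrite nst nsz.
rewrite !cmodM cmodN cmodV !cmodM.
have c2 : cmod (2 : R[i]) = 2 by rewrite -(rmorph_nat (real_complex R) 2) cmod_real normr_nat.
rewrite c2 ler_pdivrMr; last first.
  by rewrite !mulr_gt0// (lt_le_trans s0).
rewrite mulrAC ler_wpM2r ?cmod_ge0//; apply: le_trans (ltW we) _.
have -> : 2 * e * s ^+ 3 = e * (s * s * (2 * s)) by ring.
rewrite ler_pM2l//; apply: ler_pM; rewrite ?mulr_ge0 ?(ltW s0)//.
  by apply: ler_pM; rewrite ?(ltW s0).
by rewrite ler_pM2l.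
Qed.

End vector_valued.

Section boundary.
Context {R : realType} {n : nat}.
Implicit Types (p nu z : 'rV[R[i]^o]_n) (D : set 'rV[R[i]^o]_n).

(** * The domain near the boundary point *)

Lemma enorm_nbhs p (e : R) : 0 < e -> nbhs p [set z | enorm (z - p) < e].
Proof.
move=> e0; have N0 : 0 < n%:R + 1 :> R by rewrite ltr_wpDl.
have d0 : 0 < e / (n%:R + 1) by rewrite divr_gt0.
apply/nbhs_ballP; exists (e / (n%:R + 1))%:C => /=; first by rewrite ltcR.
move=> z [_ Hz] /=; apply: (@le_lt_trans _ _ (n%:R * (e / (n%:R + 1)))).
  apply: enorm_le_sum => [|j]; first exact: ltW.
  rewrite rowBE cmodBC; have := Hz 0 j.
  by rewrite /ball /= ltc_cmod => /ltW.
by rewrite mulrA ltr_pdivrMr// mulrC ltr_pM2l// ltrDl.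
Qed.

Lemma closure_enorm D p (e : R) : closure D p -> 0 < e ->
  exists2 z, D z & enorm (z - p) < e.
Proof. by move=> cl e0; have [z []] := cl _ (enorm_nbhs p e0); exists z. Qed.

(** The defining function [r] vanishes at [p] because [p] is a limit of points of the
    open set [D] without belonging to it.  Its gradient at [p] is a negative multiple
    of [nu], so the Taylor expansion reads
    [r z = - k Re <z - p, nu> + O(|z - p| ^ (1 + gamma))], and [D] is [r < 0]. *)
Lemma normal_local (gamma : R) D p nu : 0 < gamma -> open D -> bdry D p ->
  inner_unit_normal gamma D p nu ->
  enorm nu = 1 /\
  exists d L : R, [/\ 0 < d, 0 <= L & forall z, enorm (z - p) < d ->
    (D z -> - (L * enorm (z - p) `^ (1 + gamma)) <= complex.Re (herm (z - p) nu)) /\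
    (L * enorm (z - p) `^ (1 + gamma) < complex.Re (herm (z - p) nu) -> D z)].
Proof.
move=> gamma0 oD [clp nDp] [U [r [[oU Up rC rn0 DU] nuE]]].
set G := rgrad r p in nuE.
have k0 : 0 < enorm G by apply: enorm_gt0; exact: rn0.
have [k kE] : exists k, k = enorm G by eexists.
rewrite -kE in k0 nuE.
have nu1 : enorm nu = 1.
  rewrite nuE enormZ cmodN cmod_real -kE.
  by rewrite gtr0_norm ?invr_gt0// mulVf// gt_eqF.
have GE : G = (- k)%:C *: nu.
  rewrite rmorphN nuE !scaleNr scalerN opprK scalerA -rmorphM divff ?gt_eqF//.
  by rewrite scale1r.
split=> //.
have [d [L [d0 L0 HT]]] := taylor gamma0 oU Up rC.
have herG z : complex.Re (herm (z - p) G) = - (k * complex.Re (herm (z - p) nu)).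
  by rewrite GE hermZr conjc_real cReZ mulNr.
have inD z : U z -> r z < 0 -> D z.
  move=> Uz rz; have : [set z | U z /\ r z < 0] z by [].
  by rewrite -DU => -[].
have rneg z : U z -> D z -> r z < 0.
  by move=> Uz Dz; have : (D `&` U) z by []; rewrite DU => -[].
have rp0 : r p = 0.
  apply/eqP; rewrite eq_le; apply/andP; split; last first.
    rewrite leNgt; apply/negP => rp; apply: nDp.
    by apply: open_nbhs_nbhs; split=> //; exact: inD.
  rewrite leNgt; apply/negP => rp.
  have K0 : 0 < n%:R * k + L + 1.
    by rewrite ltr_wpDl// addr_ge0// mulr_ge0// ltW.
  have e0 : 0 < Num.min (Num.min d 1) (r p / (n%:R * k + L + 1)).
    by rewrite !lt_min d0 ltr01 divr_gt0.
  have [z Dz] := closure_enorm clp e0.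
  rewrite !lt_min ltr_pdivlMr// => /andP[/andP[zd z1] zr].
  have [Uz Hz] := HT z zd.
  have := rneg z Uz Dz.
  have h1 : `|complex.Re (herm (z - p) G)| <= n%:R * (enorm (z - p) * k).
    by apply: le_trans (Re_le_cmod _) _; rewrite kE; exact: cmod_herm.
  have h2 : enorm (z - p) `^ (1 + gamma) <= enorm (z - p).
    have [->|z0] := eqVneq (enorm (z - p)) 0.
      by rewrite powR0// gt_eqF// addr_gt0.
    rewrite powRD; last by rewrite z0 implybT.
    rewrite powRr1 ?enorm_ge0// ler_piMr ?enorm_ge0//.
    have -> : 1 = 1 `^ gamma by rewrite powR1.
    by apply: ge0_ler_powR; rewrite ?nnegrE ?enorm_ge0 ?(ltW gamma0) ?(ltW z1).
  have h3 := ler_wpM2l L0 h2.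
  move: Hz h1; rewrite !ler_norml => /andP[h4 _] /andP[h5 _].
  by have := enorm_ge0 (z - p); lra.
exists d, (L / k); split=> [//||z zd]; first by rewrite divr_ge0// ltW.
have [Uz] := HT z zd.
rewrite rp0 subr0 herG opprK => Hz.
set P := _ `^ _ in Hz *; have -> : L / k * P = L * P / k by ring.
rewrite -mulNr; split=> [Dz|].
  rewrite ler_pdivrMr//; have := rneg z Uz Dz.
  by move: Hz; rewrite ler_norml => /andP[? _]; lra.
rewrite ltr_pdivrMr// => h; apply: inD => //.
by move: Hz; rewrite ler_norml => /andP[_ ?]; lra.
Qed.

(** Away from [p] the bound holds for a trivial reason: [|z - p|] is bounded below,
    hence dominated by a multiple of [|z - p| ^ (1 + gamma)]. *)
Lemma normal_lower (gamma : R) D p nu : 0 < gamma -> open D -> bdry D p ->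
  inner_unit_normal gamma D p nu ->
  exists2 C : R, 0 <= C & forall z, D z ->
    - (C * enorm (z - p) `^ (1 + gamma)) <= complex.Re (herm (z - p) nu).
Proof.
move=> g0 oD bp nup; have [nu1 [d [L [d0 L0 H]]]] := normal_local g0 oD bp nup.
have dg : 0 < d `^ gamma by exact: powR_gt0.
have q0 : 0 <= n%:R / d `^ gamma by rewrite divr_ge0// ltW.
exists (L + n%:R / d `^ gamma); first exact: addr_ge0.
move=> z Dz; set t := enorm (z - p).
have t1 : 0 <= t `^ (1 + gamma) by exact: powR_ge0.
have [zd|zd] := ltP t d.
  apply: le_trans (_ : - (L * t `^ (1 + gamma)) <= _).
    by rewrite lerN2 ler_wpM2r// lerDl.
  exact: (H z zd).1.
have t0 : 0 < t by exact: lt_le_trans zd.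
have tE : t `^ (1 + gamma) = t * t `^ gamma.
  by rewrite powRD ?powRr1 ?(ltW t0)// (gt_eqF t0) implybT.
have dt : d `^ gamma <= t `^ gamma.
  by apply: ge0_ler_powR => //; rewrite ?nnegrE ltW.
have := Re_le_cmod (herm (z - p) nu); rewrite ler_norml => /andP[+ _].
apply: le_trans; rewrite lerN2; apply: le_trans (cmod_herm _ _) _.
rewrite nu1 mulr1 -/t mulrDl; apply: (@le_trans _ _ (n%:R / d `^ gamma * t `^ (1 + gamma))).
  rewrite tE -mulrA ler_wpM2l// mulrCA ler_peMr ?(ltW t0)//.
  by rewrite mulrC ler_pdivlMr// mul1r.
by rewrite lerDr mulr_ge0.
Qed.

Lemma small_powR (gamma e : R) : 0 < gamma -> 0 < e ->
  exists2 d : R, 0 < d & forall t, 0 <= t -> t <= d -> t `^ gamma <= e.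
Proof.
move=> g0 e0; exists (e `^ gamma^-1); first exact: powR_gt0.
move=> t t0 td; apply: (@le_trans _ _ ((e `^ gamma^-1) `^ gamma)).
  by apply: ge0_ler_powR => //; rewrite ?nnegrE// ?powR_ge0// ltW.
by rewrite -powRrM mulVf ?gt_eqF// powRr1// ltW.
Qed.

(** In this sector [|zeta| <= 2 Re zeta], so the linear term [Re zeta] beats the
    error [|zeta| ^ (1 + gamma)] for small [zeta]. *)
Lemma normal_cone (gamma : R) D p nu : 0 < gamma -> open D -> bdry D p ->
  inner_unit_normal gamma D p nu ->
  exists2 d : R, 0 < d & forall zeta : R[i], 0 < complex.Re zeta ->
    `|complex.Im zeta| <= complex.Re zeta -> cmod zeta < d -> D (p + zeta *: nu).
Proof.
move=> g0 oD bp nup; have [nu1 [d [L [d0 L0 H]]]] := normal_local g0 oD bp nup.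
have [d1 d10 Hd1] : exists2 d1 : R, 0 < d1 & forall t, 0 <= t -> t <= d1 ->
    t `^ gamma <= (2 * (L + 1))^-1.
  by apply: small_powR => //; rewrite invr_gt0 mulr_gt0// ltr_wpDl.
exists (Num.min d d1); first by rewrite lt_min d0.
move=> zeta z0 zim; rewrite lt_min => /andP[zd zd1].
have E : p + zeta *: nu - p = zeta *: nu by rewrite addrAC subrr add0r.
have nE : enorm (zeta *: nu) = cmod zeta by rewrite enormZ nu1 mulr1.
have zp : 0 < cmod zeta by exact: lt_le_trans z0 (Re_le _).
apply: (H _ _).2; rewrite E nE//.
rewrite hermZl herm_self nu1 expr1n mulr1.
have z2 : cmod zeta <= 2 * complex.Re zeta.
  apply: le_trans (cmod_le_ReIm _) _; rewrite (gtr0_norm z0); lra.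
rewrite powRD; last by rewrite (gt_eqF zp) implybT.
rewrite powRr1 ?cmod_ge0//.
have h := Hd1 _ (cmod_ge0 zeta) (ltW zd1).
have L1 : 0 < L + 1 by rewrite ltr_wpDl.
apply: (@le_lt_trans _ _ (L * (2 * complex.Re zeta * (2 * (L + 1))^-1))).
  by apply: ler_wpM2l => //; apply: ler_pM => //; rewrite ?cmod_ge0 ?powR_ge0.
have -> : L * (2 * complex.Re zeta * (2 * (L + 1))^-1) =
  L * complex.Re zeta / (L + 1) by field; rewrite gt_eqF.
by rewrite ltr_pdivrMr// mulrC ltr_pM2l// ltrDl.
Qed.

(** The disc [z |-> p + eps sqrt (1 + z) nu] joins the two points inside the complex
    normal line: [|sqrt (1 + z)| < 2] and its values lie in the sector of
    [normal_cone], for every ratio [delta / eps].  The parameter of the second point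
    is [(delta / eps) ^ 2 - 1]. *)
Lemma lempert_set_nonempty (gamma : R) D p nu : 0 < gamma -> open D -> bdry D p ->
  inner_unit_normal gamma D p nu ->
  exists2 e0 : R, 0 < e0 & forall delta eps : R, 0 < delta -> delta < eps ->
    eps < e0 -> exists alpha : R[i], `|alpha| < 1 /\
      exists phi, [/\ holo_disc D phi, phi 0 = p + eps%:C *: nu &
        phi alpha = p + delta%:C *: nu].
Proof.
move=> g0 oD bp nup; have [d d0 H] := normal_cone g0 oD bp nup.
exists (d / 2); first by rewrite divr_gt0.
move=> delta eps de0 dle led.
have ep0 : 0 < eps by exact: lt_trans dle.
have [x xE] : exists x, x = delta / eps by eexists.
have x0 : 0 < x by rewrite xE divr_gt0.
have x1 : x < 1 by rewrite xE ltr_pdivrMr// mul1r.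
have xx : x ^+ 2 < 1 by rewrite expr_lt1// ltW.
have xx0 : 0 < x ^+ 2 by rewrite exprn_gt0.
exists (x ^+ 2 - 1)%:C; split.
  by rewrite cmod_lt1 cmod_real ltr_norml; lra.
exists (fun z : R[i] => p + (eps%:C * sqrtc (z + 1)) *: nu); split.
- move=> z z1; rewrite cmod_lt1 in z1.
  have w0 : 0 < complex.Re (z + 1).
    by rewrite cReD /=; have := Re_le_cmod z; rewrite ler_norml => /andP[? _]; lra.
  have [s0 s1] := Re_sqrtc w0.
  split.
    apply: (@derivable_line _ _ (fun z : R[i] => eps%:C * sqrtc (z + 1))).
    apply: derivable_cM; first exact: derivable_ccst.
    have := derivable_sqrtc w0 => /cderivable_lin[l Hl].
    apply: (@lin_cderivable _ _ _ l) => e e0; have [r r0 Hr] := Hl e e0.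
    exists r => // w wz; have := Hr (w + 1).
    by rewrite (_ : w + 1 - (z + 1) = w - z); [exact|ring].
  apply: H.
  + by rewrite cReZ mulr_gt0.
  + rewrite cReZ cImM /= mul0r addr0 normrM (gtr0_norm ep0).
    by rewrite ler_pM2l.
  + rewrite cmodM cmod_real (gtr0_norm ep0).
    have : cmod (sqrtc (z + 1)) ^+ 2 < 2 ^+ 2.
      rewrite expr2 -cmodM -expr2 sqr_sqrtc; apply: le_lt_trans (cmodD _ _) _.
      by rewrite cmod1; lra.
    rewrite ltr_pXn2r ?nnegrE ?cmod_ge0// => h.
    apply: (@lt_trans _ _ (eps * 2)); first by rewrite ltr_pM2l.
    by rewrite -ltr_pdivlMr.
- by rewrite add0r sqrtc1 mulr1.
- have -> : (x ^+ 2 - 1)%:C + 1 = (x ^+ 2)%:C.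
    by rewrite rmorphB rmorph1 subrK.
  rewrite sqrtc_sqrtr; last by rewrite ler0c ltW.
  rewrite [complex.Re _]/= sqrtr_sqr (gtr0_norm x0).
  by rewrite -rmorphM xE mulrC divfK// gt_eqF.
Qed.

End boundary.

Section disc_growth.
Context {R : realType} {n : nat}.

(** * Growth of an analytic disc through two points of the normal *)

Lemma bounded_coord (D : set 'rV[R[i]^o]_n) : bounded_set D ->
  exists2 M : R, 0 <= M & forall z, D z -> forall j, cmod (z 0 j) <= M.
Proof.
move=> [M0 [M0r H]].
exists (cmod M0 + 1 + 1); first by rewrite !addr_ge0 ?cmod_ge0.
move=> z Dz j.
have lM : M0 < (cmod M0 + 1)%:C.
  move: M0r => /complex_realP[m mE]; rewrite mE ltcR cmod_real.
  by apply: le_lt_trans (ler_norm _) _; rewrite ltrDl.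
have : ball (0 : 'rV[R[i]^o]_n) (cmod M0 + 1 + 1)%:C z.
  rewrite mx_norm_ball /ball_ /= sub0r normrN.
  by apply: le_lt_trans (H _ lM z Dz) _; rewrite ltcR ltrDl.
move=> [_ /(_ 0 j)]; rewrite /ball /= mxE sub0r normrN ltc_cmod.
exact: ltW.
Qed.

Lemma derivable_herm (phi : R[i]^o -> 'rV[R[i]^o]_n) (p nu : 'rV[R[i]^o]_n)
    (z : R[i]^o) : derivable phi z 1 ->
  derivable ((fun w => herm (phi w - p) nu) : R[i]^o -> R[i]^o) z 1.
Proof.
move=> dphi; rewrite /herm.
elim: (index_enum 'I_n) => [|j s IH].
  rewrite (_ : (fun _ => _) = (fun=> 0)); first exact: derivable_ccst.
  by apply/funext => w; rewrite big_nil.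
rewrite (_ : (fun _ => _) = (fun w : R[i] =>
    ((phi w 0 j : R[i]) + - (p 0 j : R[i])) * conjc (nu 0 j : R[i]) +
    \sum_(j <- s) ((phi w - p) 0 j : R[i]) * conjc (nu 0 j : R[i]))); last first.
  by apply/funext => w; rewrite big_cons rowBE.
apply: derivable_cD; last exact: IH.
apply: derivable_cM; last exact: derivable_ccst.
by apply: derivable_cD; [exact: derivable_coord|exact: derivable_ccst].
Qed.

Lemma closed_square_half_disc (z : R[i]) (s : R) : s <= 1 / 2 -> closed_square s z -> `|z| < 1.
Proof.
move=> s2 [h1 h2]; rewrite cmod_lt1.
have : cmod z ^+ 2 < 1.
  rewrite cmod_sqr -(real_normK (num_real (complex.Re z))).
  rewrite -(real_normK (num_real (complex.Im z))).
  have q (x : R) : 0 <= x -> x <= 1 / 2 -> x ^+ 2 <= 1 / 4.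
    move=> x0 x2; have -> : 1 / 4 = (1 / 2) ^+ 2 :> R by field.
    by rewrite ler_pXn2r ?nnegrE//; lra.
  have := q _ (normr_ge0 _) (le_trans h1 s2).
  have := q _ (normr_ge0 _) (le_trans h2 s2); lra.
by rewrite expr_lt1// cmod_ge0.
Qed.

Lemma closed_square_cmod (z : R[i]) (s : R) : closed_square s z -> cmod z <= 2 * s.
Proof. by move=> [h1 h2]; apply: le_trans (cmod_le_ReIm _) _; lra. Qed.

Definition normal_disc (D : set 'rV[R[i]^o]_n) (p nu : 'rV[R[i]^o]_n)
    (phi : R[i] -> 'rV[R[i]^o]_n) (eps delta : R) (alpha : R[i]) : Prop :=
  [/\ holo_disc D phi, phi 0 = p + eps%:C *: nu,
      phi alpha = p + delta%:C *: nu, 0 < delta & delta < eps].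

Section disc.
Variables (D : set 'rV[R[i]^o]_n) (p nu : 'rV[R[i]^o]_n) (gamma C M : R).
Hypotheses (gamma0 : 0 < gamma) (C0 : 0 <= C) (M0 : 0 <= M) (nu1 : enorm nu = 1).
Hypothesis DM : forall z, D z -> forall j, cmod (z 0 j) <= M.
Hypothesis DC : forall z, D z ->
    - (C * enorm (z - p) `^ (1 + gamma)) <= complex.Re (herm (z - p) nu).
Variables (phi : R[i] -> 'rV[R[i]^o]_n) (eps delta : R) (alpha : R[i]).
Hypothesis nd : normal_disc D p nu phi eps delta alpha.

Let hphi : holo_disc D phi. Proof. by case: nd. Qed.
Let phi0 : phi 0 = p + eps%:C *: nu. Proof. by case: nd. Qed.
Let phia : phi alpha = p + delta%:C *: nu. Proof. by case: nd. Qed.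
Let delta0 : 0 < delta. Proof. by case: nd. Qed.
Let de : delta < eps. Proof. by case: nd. Qed.

Lemma normal_disc_alpha : alpha != 0.
Proof.
apply/eqP => a0; move: phia; rewrite a0 phi0 => /addrI/(congr1 enorm).
rewrite !enormZ nu1 !mulr1 !cmod_real (gtr0_norm delta0).
rewrite (gtr0_norm (lt_trans delta0 de)) => E.
by move: de; rewrite E ltxx.
Qed.

(** The normal component of [phi - p] takes values in a half-plane whose boundary
    is at distance [C * X ^ (1 + gamma)] from 0.  The constant [C + 1] serves to
    satisfy the hypothesis [eps <= B] of [halfplane_schwarz]. *)
Lemma disc_step (s X : R) : 0 < s -> s <= 1 / 2 -> 0 < X ->
  (forall z, closed_square s z -> enorm (phi z - p) <= X) ->
  eps <= X `^ (1 + gamma) ->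
  (eps - delta) * s <= 16 * ((C + 1) * X `^ (1 + gamma)) * cmod alpha.
Proof.
move=> s0 s2 X0 HX eX.
have P0 : 0 < X `^ (1 + gamma) by exact: powR_gt0.
apply: (@halfplane_schwarz _ (fun z => herm (phi z - p) nu)) => //.
- move=> z zs; apply: derivable_herm.
  by have [] := hphi (closed_square_half_disc s2 zs).
- move=> z zs; have [_ Dz] := hphi (closed_square_half_disc s2 zs).
  apply: le_trans (DC Dz); rewrite lerN2.
  apply: (@le_trans _ _ (C * X `^ (1 + gamma))).
    apply: ler_wpM2l => //; apply: ge0_ler_powR (HX z zs).
    + by rewrite addr_ge0// ltW.
    + by rewrite nnegrE enorm_ge0.
    + by rewrite nnegrE ltW.
  by apply: ler_wpM2r; [exact: ltW|rewrite lerDl].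
- by rewrite phi0 addrAC subrr add0r hermZl herm_self nu1 expr1n mulr1.
- by rewrite phia addrAC subrr add0r hermZl herm_self nu1 expr1n mulr1.
- by rewrite (le_trans eX)// mulrDl mul1r lerDr mulr_ge0// ltW.
Qed.

Let phij j : R[i]^o -> R[i]^o := fun z => phi z 0 j.

Let phij_derivable j z : `|z| < 1 -> derivable (phij j) z 1.
Proof. by move=> /hphi[dphi _]; exact: derivable_coord. Qed.

Let phij_hol j : holo_off [::] (1 / 2) (phij j).
Proof.
apply: derivable_holo_off => z zs; apply: phij_derivable.
exact: closed_square_half_disc zs.
Qed.

Let half0 : 0 < 1 / 2 :> R. Proof. by rewrite divr_gt0. Qed.

Lemma first_quot_bound j z : closed_square (1 / 2) z ->
  cmod (diff_quot (phij j) 0 z) <= 8 * M.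
Proof.
have -> : 8 * M = 4 * M / (1 / 2) by field.
apply: (diff_quot_bound half0 _ _ (phij_hol j)) => //.
  by rewrite cmod0 divr_ge0// ltW.
move=> w ws; have [_ Dw] := hphi (closed_square_half_disc (lexx _) ws).
exact: DM.
Qed.

Let nu_le j : cmod (nu 0 j) <= 1.
Proof. by rewrite -nu1; exact: cmod_le_enorm. Qed.

Let eps0 : 0 < eps. Proof. exact: lt_trans de. Qed.

Let base_le j : cmod (phij j 0 - p 0 j) <= eps.
Proof.
rewrite /phij phi0 rowDE addrAC subrr add0r rowZE cmodM cmod_real.
by rewrite gtr0_norm// ler_piMr// ltW.
Qed.

Lemma first_growth z : closed_square (1 / 2) z ->
  enorm (phi z - p) <= n%:R * (eps + 8 * M * cmod z).
Proof.
move=> zs; apply: enorm_le_sum => [|j].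
  by rewrite addr_ge0 ?(ltW eps0)// !mulr_ge0// cmod_ge0.
rewrite rowBE -[phi z 0 j]/(phij j z) (diff_quotM (phij j) 0 z) subr0 addrAC.
apply: le_trans (cmodD _ _) _; apply: lerD; first exact: base_le.
by rewrite cmodM ler_wpM2r ?cmod_ge0//; exact: first_quot_bound.
Qed.

(** Newton interpolation at the nodes 0 and [alpha]: the difference quotient of
    [phi_j] at the two nodes is [(delta - eps) nu_j / alpha], of modulus at most the
    speed, since both values lie on the real normal line through [p].  The quotient of
    second order is bounded by iterating [diff_quot_bound], whence
    [64 M = 4 (8 M) / (1 / 2)]. *)
Lemma second_growth z : cmod alpha <= 1 / 4 -> closed_square (1 / 2) z ->
  enorm (phi z - p) <=
    n%:R * (eps + ((eps - delta) / cmod alpha + 64 * M * cmod (z - alpha)) * cmod z).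
Proof.
move=> a4 zs.
have ca0 : 0 < cmod alpha by rewrite cmod_gt0 normal_disc_alpha.
have t0 : 0 <= (eps - delta) / cmod alpha by rewrite divr_ge0 ?cmod_ge0// subr_ge0 ltW.
apply: enorm_le_sum => [|j].
  apply: addr_ge0; first exact: ltW.
  by rewrite mulr_ge0 ?cmod_ge0// addr_ge0// !mulr_ge0// cmod_ge0.
rewrite rowBE -[phi z 0 j]/(phij j z) (diff_quotM (phij j) 0 z) subr0 addrAC.
apply: le_trans (cmodD _ _) _; apply: lerD; first exact: base_le.
rewrite cmodM ler_wpM2r ?cmod_ge0// (diff_quotM (diff_quot (phij j) 0) alpha z).
apply: le_trans (cmodD _ _) _; apply: lerD.
  rewrite diff_quotE ?normal_disc_alpha// subr0 cmodM cmodV ler_wpM2r ?invr_ge0 ?cmod_ge0//.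
  rewrite /phij phia phi0 !rowDE !rowZE.
  have -> : (p 0 j : R[i]) + delta%:C * (nu 0 j : R[i]) - (p 0 j + eps%:C * (nu 0 j : R[i])) =
    (delta - eps)%:C * nu 0 j by rewrite rmorphB; ring.
  rewrite cmodM cmod_real ltr0_norm ?subr_lt0// opprB ler_piMr// subr_ge0.
  exact: ltW.
rewrite cmodM ler_wpM2r ?cmod_ge0//.
have -> : 64 * M = 4 * (8 * M) / (1 / 2) by field.
apply: (@diff_quot_bound _ [:: 0] _ _ _ _ half0) => //.
- by rewrite (le_trans a4)//; lra.
- by rewrite inE normal_disc_alpha.
- apply: diff_quot_holo_off => //; split; rewrite /= normr0; exact: half0.
- by move=> w; exact: first_quot_bound.
Qed.

End disc.

End disc_growth.

(** * Comparison of powers *)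

Section powers.
Context {R : realType}.
Implicit Types x a : R.

Lemma powR_split (x a b : R) : 0 < x -> x `^ (a + b) = x `^ a * x `^ b.
Proof. by move=> x0; rewrite powRD// (gt_eqF x0) implybT. Qed.

Lemma powR_le1 (x a : R) : 0 <= x -> x <= 1 -> 0 <= a -> x `^ a <= 1.
Proof.
move=> x0 x1 a0; have -> : 1 = 1 `^ a by rewrite powR1.
by apply: ge0_ler_powR; rewrite ?nnegrE.
Qed.

(** The weighted arithmetic-geometric mean inequality for [x] and 1 with weights
    [a] and [1 - a]. *)
Lemma powR_upper x a : 0 < x -> 0 < a -> a < 1 -> x `^ a <= 1 - a * (1 - x).
Proof.
move=> x0 a0 a1; have b0 : 0 < 1 - a by rewrite subr_gt0.
have := @conjugate_powR R (x `^ a) 1 a^-1 (1 - a)^-1 (powR_ge0 _ _) ler01.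
rewrite !invr_gt0 !invrK => /(_ a0 b0); rewrite addrC subrK => /(_ erefl).
rewrite mulr1 powR1 -powRrM mulfV ?gt_eqF// powRr1 ?(ltW x0)//; lra.
Qed.

Lemma asymp_diff a : 0 < a -> a < 1 ->
  asymp (fun eps delta => (eps - delta) * eps `^ (a - 1))
        (fun eps delta => eps `^ a - delta `^ a).
Proof.
move=> a0 a1.
have key (delta eps : R) : 0 < delta -> delta < eps ->
    a * ((eps - delta) * eps `^ (a - 1)) <= eps `^ a - delta `^ a /\
    eps `^ a - delta `^ a <= (eps - delta) * eps `^ (a - 1).
  move=> d0 de; have e0 := lt_trans d0 de.
  set x := delta / eps.
  have x0 : 0 < x by rewrite divr_gt0.
  have x1 : x < 1 by rewrite ltr_pdivrMr// mul1r.
  have E : eps `^ a = eps `^ (a - 1) * eps by rewrite mulrC mulr_powRB1// ltW.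
  have Ed : delta `^ a = x `^ a * eps `^ a.
    by rewrite -powRM ?(ltW x0) ?(ltW e0)// divfK// gt_eqF.
  have P0 : 0 < eps `^ (a - 1) by exact: powR_gt0.
  have -> : eps `^ a - delta `^ a = (1 - x `^ a) * eps * eps `^ (a - 1).
    by rewrite Ed E; ring.
  have -> : eps - delta = (1 - x) * eps by rewrite /x; field; rewrite gt_eqF.
  rewrite [a * _]mulrA; split; rewrite ler_pM2r//; last first.
    by rewrite ler_pM2r// lerD2l lerN2 ger1_powR ?x0 ?ltW.
  rewrite mulrA ler_pM2r//; have := powR_upper x0 a0 a1; lra.
split; [exists 1, 1|exists a, 1]; split=> // delta eps d0 de _.
  by rewrite mul1r; exact: (key _ _ d0 de).2.
exact: (key _ _ d0 de).1.
Qed.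

End powers.

(** * The lower bound *)

Section estimate.
Context {R : realType} {n : nat}.
Variables (D : set 'rV[R[i]^o]_n) (p nu : 'rV[R[i]^o]_n) (gamma C M : R).
Hypotheses (gamma0 : 0 < gamma) (C0 : 0 <= C) (M0 : 0 <= M) (nu1 : enorm nu = 1).
Hypothesis DM : forall z, D z -> forall j, cmod (z 0 j) <= M.
Hypothesis DC : forall z, D z ->
    - (C * enorm (z - p) `^ (1 + gamma)) <= complex.Re (herm (z - p) nu).

(** With a fixed scale [s] and [X = K s], [disc_step] bounds the speed by
    [A * s ^ gamma], where [s] may be chosen as small as desired before [eps]. *)
Lemma speed_small (t0 : R) : 0 < t0 -> exists2 e0 : R, 0 < e0 &
  forall phi eps delta alpha, normal_disc D p nu phi eps delta alpha -> eps < e0 ->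
    (eps - delta) / cmod alpha <= t0.
Proof.
move=> t00.
pose K := n%:R * (1 + 16 * M) + 1.
have K1 : 1 <= K.
  rewrite lerDr; apply: mulr_ge0; first exact: ler0n.
  by apply: addr_ge0; [exact: ler01|apply: mulr_ge0; [exact: ler0n|]].
have K0 : 0 < K by exact: lt_le_trans K1.
pose A := 16 * ((C + 1) * K `^ (1 + gamma)).
have A0 : 0 < A.
  by rewrite !mulr_gt0 ?powR_gt0// ltr_wpDl.
have [s1 s10 Hs1] := small_powR gamma0 (divr_gt0 t00 A0).
have [s [s0 s2 ss1]] : exists s, [/\ 0 < s, s <= 1 / 2 & s <= s1].
  exists (Num.min (1 / 2) s1).
  by split; rewrite ?lt_min ?s10 ?divr_gt0// ge_min lexx ?orbT.
exists (s `^ (1 + gamma)); first exact: powR_gt0.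
move=> phi eps delta alpha nd es.
have ca0 : 0 < cmod alpha by rewrite cmod_gt0; exact: (normal_disc_alpha nu1 nd).
have [_ _ _ d0 de] := nd.
have e0 := lt_trans d0 de.
have es' : eps <= s.
  apply: le_trans (ltW es) _; rewrite powR_split// powRr1 ?(ltW s0)//.
  rewrite ler_piMr ?(ltW s0)//; apply: powR_le1; rewrite ?(ltW s0) ?(ltW gamma0)//.
  by lra.
have := disc_step gamma0 C0 nu1 DC nd s0 s2 (mulr_gt0 K0 s0).
have step1 : forall z, closed_square s z -> enorm (phi z - p) <= K * s.
  move=> z zs; have zs2 : closed_square (1 / 2) z.
    by case: zs => h1 h2; split; [exact: le_trans h1 s2|exact: le_trans h2 s2].
  apply: le_trans (first_growth M0 nu1 DM nd zs2) _.
  apply: (@le_trans _ _ (n%:R * (s + 8 * M * (2 * s)))).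
    apply: ler_wpM2l => //; apply: lerD => //; apply: ler_wpM2l.
      by rewrite mulr_ge0.
    exact: closed_square_cmod.
  have -> : n%:R * (s + 8 * M * (2 * s)) = n%:R * (1 + 16 * M) * s by ring.
  by apply: ler_wpM2r; [exact: ltW|rewrite lerDl].
move=> /(_ step1).
have step2 : eps <= (K * s) `^ (1 + gamma).
  apply: le_trans (ltW es) _; apply: ge0_ler_powR; rewrite ?nnegrE.
  - by rewrite addr_ge0// ltW.
  - exact: ltW.
  - by rewrite mulr_ge0 ?(ltW K0) ?(ltW s0).
  - by rewrite ler_peMl// ltW.
move=> /(_ step2); rewrite powRM ?(ltW K0) ?(ltW s0)//.
rewrite (powR_split 1 gamma s0) powRr1 ?(ltW s0)// => h.
rewrite ler_pdivrMr// -(ler_pM2r s0); apply: le_trans h _.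
have -> : 16 * ((C + 1) * (K `^ (1 + gamma) * (s * s `^ gamma))) * cmod alpha =
   A * s `^ gamma * (cmod alpha * s) by rewrite /A; ring.
rewrite -[leRHS]mulrA; apply: ler_wpM2r; first by rewrite mulr_ge0// ltW.
rewrite mulrC -ler_pdivlMr//; apply: Hs1 => //; exact: ltW.
Qed.

(** The case [|alpha| >= eps ^ a] is trivial because
    [(eps - delta) * eps ^ (a - 1) <= eps ^ a].  Otherwise [disc_step] is used on the
    scale [s = max (t, eps ^ a)] with [X = K s ^ 2]: all terms of [second_growth] are
    then [O(s ^ 2)], and [eps = (eps ^ a) ^ m <= s ^ m] for [m = 2 (1 + gamma)], which
    is the power of [s] in [X ^ (1 + gamma)].  This gives [t * s <= A * s ^ m], and
    [s = t] would mean [1 <= A * t ^ (2 gamma)]. *)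
Lemma normal_disc_lower : exists c e0 : R, [/\ 0 < c, 0 < e0 &
  forall phi eps delta alpha, normal_disc D p nu phi eps delta alpha -> eps < e0 ->
    c * ((eps - delta) * eps `^ ((2 * (1 + gamma))^-1 - 1)) <= cmod alpha].
Proof.
pose m := 2 * (1 + gamma); set a := (2 * (1 + gamma))^-1.
have g1 : 0 < 1 + gamma by rewrite addr_gt0.
have m0 : 0 < m by rewrite mulr_gt0.
have m2 : 2 <= m by have := gamma0; rewrite /m; lra.
have a0 : 0 < a by rewrite invr_gt0.
have am : a * m = 1 by rewrite mulVf// gt_eqF.
pose K := n%:R * (3 + 384 * M) + 1.
have K1 : 1 <= K.
  rewrite lerDr; apply: mulr_ge0; first exact: ler0n.
  by apply: addr_ge0; [exact: ler0n|apply: mulr_ge0; [exact: ler0n|]].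
have K0 : 0 < K by exact: lt_le_trans K1.
pose A := 16 * ((C + 1) * K `^ (1 + gamma)).
have A0 : 0 < A by rewrite !mulr_gt0 ?powR_gt0// ltr_wpDl.
have A1 : 1 <= A.
  have h1 : 1 <= C + 1 by rewrite lerDr.
  have h2 : 1 <= K `^ (1 + gamma).
    have {1}-> : 1 = 1 `^ (1 + gamma) by rewrite powR1.
    by apply: ge0_ler_powR; rewrite ?nnegrE ?(ltW g1) ?(ltW K0).
  have : 1 * 1 <= (C + 1) * K `^ (1 + gamma) by apply: ler_pM.
  by rewrite /A; lra.
have g20 : 0 < 2 * gamma by rewrite mulr_gt0.
have iA : 0 < (2 * A)^-1 by rewrite invr_gt0 mulr_gt0.
(* Below [t1] one has [A * t ^ (2 gamma) <= 1 / 2], which excludes [s = t]. *)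
have [t1 t10 Ht1] := small_powR g20 iA.
have q0 : 0 < 1 / 4 :> R by rewrite divr_gt0.
have t00 : 0 < Num.min t1 (1 / 2) by rewrite lt_min t10 divr_gt0.
have [e1 e10 He1] := speed_small t00.
have [e2 e20 He2] := small_powR a0 q0.
exists A^-1, (Num.min e1 e2); split; first by rewrite invr_gt0.
  by rewrite lt_min e10.
move=> phi eps delta alpha nd; rewrite lt_min => /andP[ee1 ee2].
have := He1 _ _ _ _ nd ee1; rewrite le_min.
have ca0 : 0 < cmod alpha by rewrite cmod_gt0; exact: (normal_disc_alpha nu1 nd).
have [_ _ _ d0 de] := nd.
set t := (eps - delta) / cmod alpha => /andP[tt1 t2].
have e0 := lt_trans d0 de.
have t0 : 0 < t by rewrite divr_gt0// subr_gt0.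
have tE : eps - delta = t * cmod alpha by rewrite divfK// gt_eqF.
set u := eps `^ a.
have u0 : 0 < u by exact: powR_gt0.
have u4 : u <= 1 / 4 by apply: He2; exact: ltW.
have um : u `^ m = eps by rewrite -powRrM am powRr1// ltW.
have P0 : 0 < eps `^ (a - 1) by exact: powR_gt0.
have Pe : eps * eps `^ (a - 1) = u by rewrite mulr_powRB1// ltW.
rewrite mulrC ler_pdivrMr//.
have [ua|au] := leP u (cmod alpha).
  apply: (@le_trans _ _ u).
    by rewrite -Pe ler_wpM2r ?(ltW P0)// lerBlDr lerDl ltW.
  by rewrite -[leLHS]mulr1; apply: ler_pM => //; exact: ltW.
pose s := Num.max t u.
have us : u <= s by rewrite le_max lexx orbT.
have ts : t <= s by rewrite le_max lexx.
have s0 : 0 < s by exact: lt_le_trans us.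
have s2 : s <= 1 / 2 by rewrite ge_max t2 /=; lra.
have sm : eps <= s `^ m.
  by rewrite -um; apply: ge0_ler_powR; rewrite ?nnegrE ?(ltW m0) ?(ltW u0) ?(ltW s0).
have s2E : s ^+ 2 = s `^ 2 by rewrite powR_mulrn// ltW.
have es2 : eps <= s ^+ 2.
  apply: le_trans sm _; rewrite s2E; apply: ger_powR => //.
  by rewrite s0 /=; lra.
have X0 : 0 < K * s ^+ 2 by rewrite mulr_gt0// exprn_gt0.
have XE : (K * s ^+ 2) `^ (1 + gamma) = K `^ (1 + gamma) * s `^ m.
  by rewrite powRM ?(ltW K0) ?sqr_ge0// s2E -powRrM.
have := disc_step gamma0 C0 nu1 DC nd s0 s2 X0.
(* On the square [|z| <= 2 s] and [|z - alpha| <= 3 s]: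
   [s ^ 2 + (s + 64 M (3 s)) (2 s) = (3 + 384 M) s ^ 2]. *)
have step1 : forall z, closed_square s z -> enorm (phi z - p) <= K * s ^+ 2.
  move=> z zs; have zs2 : closed_square (1 / 2) z.
    by case: zs => h1 h2; split; [exact: le_trans h1 s2|exact: le_trans h2 s2].
  have a4 : cmod alpha <= 1 / 4 by lra.
  apply: le_trans (second_growth M0 nu1 DM nd a4 zs2) _.
  rewrite -/t; have zc := closed_square_cmod zs.
  have zac : cmod (z - alpha) <= 3 * s.
    by apply: le_trans (cmodB _ _) _; lra.
  apply: (@le_trans _ _ (n%:R * (s ^+ 2 + (s + 64 * M * (3 * s)) * (2 * s)))).
    apply: ler_wpM2l => //; apply: lerD => //; apply: ler_pM; rewrite ?cmod_ge0//.
      by rewrite addr_ge0 ?(ltW t0)// !mulr_ge0// cmod_ge0.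
    by apply: lerD => //; apply: ler_wpM2l => //; rewrite mulr_ge0.
  have -> : n%:R * (s ^+ 2 + (s + 64 * M * (3 * s)) * (2 * s)) =
    n%:R * (3 + 384 * M) * s ^+ 2 by ring.
  by apply: ler_wpM2r; [exact: sqr_ge0|rewrite lerDl].
move=> /(_ step1).
have step2 : eps <= (K * s ^+ 2) `^ (1 + gamma).
  rewrite XE; apply: le_trans sm _; rewrite ler_peMl ?powR_ge0//.
  have {1}-> : 1 = 1 `^ (1 + gamma) by rewrite powR1.
  by apply: ge0_ler_powR; rewrite ?nnegrE ?(ltW g1) ?(ltW K0).
move=> /(_ step2); rewrite XE tE.
have -> : 16 * ((C + 1) * (K `^ (1 + gamma) * s `^ m)) * cmod alpha =
  A * s `^ m * cmod alpha by rewrite /A; ring.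
rewrite mulrAC ler_pM2r// => key.
have [tu|ut] := leP t u.
  have sE : s = u by rewrite /s; apply/max_idPr.
  rewrite sE um in key.
  rewrite -(ler_pM2r u0) mulrAC.
  have -> : t * cmod alpha * u * eps `^ (a - 1) = (t * u) * (cmod alpha * eps `^ (a - 1)).
    by ring.
  apply: le_trans (ler_wpM2r _ key) _; first by rewrite mulr_ge0// ltW.
  have -> : A * eps * (cmod alpha * eps `^ (a - 1)) =
    cmod alpha * A * (eps * eps `^ (a - 1)) by ring.
  by rewrite Pe.
have sE : s = t by rewrite /s; apply/max_idPl/ltW.
exfalso; move: key; rewrite sE.
have -> : m = 2 + 2 * gamma by rewrite /m; ring.
rewrite powR_split// -[t `^ 2]/(t `^ 2%:R) powR_mulrn ?(ltW t0)// -expr2.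
rewrite mulrCA -[leLHS]mulr1 ler_pM2l ?exprn_gt0// => key.
have := ler_wpM2l (ltW A0) (Ht1 t (ltW t0) tt1).
rewrite invfM mulrCA mulfV ?gt_eqF// => h; lra.
Qed.

End estimate.

Theorem proposition12 (R : realType) (n : nat) (gamma : R)
    (D : set 'rV[R[i]^o]_n) (p nu : 'rV[R[i]^o]_n) :
  (0 < n)%N -> 0 < gamma -> gamma <= 1 ->
  domain D -> bounded_set D -> C1gamma_smooth gamma D ->
  bdry D p -> inner_unit_normal gamma D p nu ->
  gtrsim (fun eps delta => lempert D (p + eps%:C *: nu) (p + delta%:C *: nu))
         (fun eps delta =>
            (eps - delta) * eps `^ ((2 * (1 + gamma))^-1 - 1)) /\
  asymp (fun eps delta => (eps - delta) * eps `^ ((2 * (1 + gamma))^-1 - 1))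
        (fun eps delta =>
           eps `^ ((2 * (1 + gamma))^-1) - delta `^ ((2 * (1 + gamma))^-1)).
Proof.
move=> _ gamma0 _ [oD _ _] bD _ bp nup; split; last first.
  by apply: asymp_diff; rewrite ?invr_gt0 ?invf_lt1; lra.
have [nu1 _] := normal_local gamma0 oD bp nup.
have [C C0 DC] := normal_lower gamma0 oD bp nup.
have [M M0 DM] := bounded_coord bD.
have [c [e1 [c0 e10 H1]]] := normal_disc_lower gamma0 C0 M0 nu1 DM DC.
have [e2 e20 H2] := lempert_set_nonempty gamma0 oD bp nup.
exists c, (Num.min e1 e2); split=> //; first by rewrite lt_min e10.
move=> delta eps d0 de; rewrite lt_min => /andP[ee1 ee2].
apply: lb_le_inf.
  have [alpha Ha] := H2 _ _ d0 de ee2.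
  by exists (cmod alpha), alpha.
by move=> _ [alpha [_ [phi [hphi phi0 phia]]] <-]; exact: (H1 phi eps delta).
Qed.
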